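(* Let $X$ be a micro-transitive complex Banach space. Then the pair $(c_0(X),c_0(X))$ has the property $\mathbf{L}_{p,p}$ for bilinear forms. That is, for each $\varepsilon>0$ and each $(x_0,y_0)\in S_{c_0(X)}\times S_{c_0(X)}$ there exists $\eta(\varepsilon,x_0,y_0)>0$ such that whenever $T\in S_{\mathcal{L}^2(c_0(X)\times c_0(X))}$ satisfies $|T(x_0,y_0)|>1-\eta(\varepsilon,x_0,y_0)$, there exists $S\in S_{\mathcal{L}^2(c_0(X)\times c_0(X))}$ with $$|S(x_0,y_0)|=1\quad\text{and}\quad\|S-T\|<\varepsilon.$$
   Context: For a Banach space $Z$, $S_Z$ denotes its unit sphere. $c_0(X)=\bigl[\oplus_{i=1}^\infty X\bigr]_{c_0}$ is the space of sequences $x=(x(i))_{i\in\mathbb{N}}$ in $X$ with $\|x(i)\|\to 0$, normed by $\|x\|=\sup_i\|x(i)\|$. For Banach spaces $Z,W$ over $\mathbb{C}$, $\mathcal{L}^2(Z\times W)$ is the Banach space of bounded bilinear forms $T\colon Z\times W\to\mathbb{C}$ with norm $\|T\|=\sup\{|T(z,w)|:\|z\|\le 1,\|w\|\le 1\}$. A Banach space $X$ is micro-transitive if for every $\varepsilon>0$ there exists $0<\theta(\varepsilon)<\varepsilon$ such that whenever $x,y\in S_X$ satisfy $\|x-y\|<\theta(\varepsilon)$, there exists a linear isometry $U\colon X\to X$ such that $Ux=y$ and $\|U-I\|<\varepsilon$, where $I$ is the identity operator on $X$. *)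

(* Defs.v *)
From HB Require Import structures.
From mathcomp Require Import all_boot all_order all_algebra.
From mathcomp Require Import all_classical all_reals all_analysis.
From mathcomp Require Import complex.

Set Implicit Arguments.
Unset Strict Implicit.
Unset Printing Implicit Defensive.

Import Order.TTheory GRing.Theory Num.Theory.
Import numFieldNormedType.Exports.

Local Open Scope classical_set_scope.
Local Open Scope ring_scope.
Local Open Scope complex_scope.

(* In a normed space over R[i] the norm `|x| lives in R[i], where it is a     *)
(* nonnegative real number; rnorm x is that number as an element of R.        *)
Definition rnorm (R : realType) (V : normedZmodType R[i]) (x : V) : R :=
  complex.Re `|x|.

Section rnorm_theory.
Context {R : realType}.

Lemma rnormE (V : normedZmodType R[i]) (x : V) : (rnorm x)%:C = `|x|.
Proof. by rewrite /rnorm RRe_real// normr_real. Qed.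

Lemma rnorm_ge0 (V : normedZmodType R[i]) (x : V) : 0 <= rnorm x.
Proof. by rewrite -ler0c rnormE. Qed.

Lemma rnorm0 (V : normedZmodType R[i]) : rnorm (0 : V) = 0.
Proof. by rewrite /rnorm normr0. Qed.

Lemma rnormD (V : normedZmodType R[i]) (x y : V) :
  rnorm (x + y) <= rnorm x + rnorm y.
Proof. by rewrite -lecR rmorphD/= !rnormE ler_normD. Qed.

Lemma rnormZ (V : normedModType R[i]) (a : R[i]) (x : V) :
  rnorm (a *: x) = rnorm a * rnorm x.
Proof. by apply: complexI; rewrite rmorphM/= !rnormE normrZ. Qed.

Lemma rnorm_eq0 (V : normedZmodType R[i]) (x : V) : rnorm x = 0 -> x = 0.
Proof. by move=> x0; apply/normr0_eq0; rewrite -rnormE x0. Qed.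

End rnorm_theory.

Definition unit_sphere (R : realType) (Z : normedModType R[i]) : set Z :=
  [set z | rnorm z = 1].

(* The supremum is meaningful because it is only used for bounded f. *)
Definition opnorm (R : realType) (Z W : normedModType R[i]) (f : Z -> W) : R :=
  sup [set rnorm (f z) | z in [set z | rnorm z <= 1]].

Definition micro_transitive (R : realType) (X : normedModType R[i]) : Prop :=
  forall eps : R, 0 < eps -> exists theta : R, 0 < theta < eps /\
    forall x y : X, unit_sphere x -> unit_sphere y -> rnorm (x - y) < theta ->
      exists U : {linear X -> X},
        [/\ forall z, rnorm (U z) = rnorm z,
            U x = y &
            opnorm (fun z => U z - z) < eps].

Section c0.
Context {R : realType} (X : normedModType R[i]).

Definition c0_pred : {pred nat -> X} :=
  [pred x | `[< rnorm (x i) @[i --> \oo] --> (0 : R) >]].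

Record c0 := C0 { c0_seq :> nat -> X; _ : c0_seq \in c0_pred }.

HB.instance Definition _ := [isSub for c0_seq].
HB.instance Definition _ := [Choice of c0 by <:].

Lemma c0P (x : c0) : rnorm (x i) @[i --> \oo] --> (0 : R).
Proof. by have /asboolP := valP x. Qed.

Lemma c0_submod_closed : submod_closed c0_pred.
Proof.
split=> [|a x y /asboolP x0 /asboolP y0]; apply/asboolP.
  rewrite (_ : (fun _ => _) = fun=> 0); first exact: cvg_cst.
  by apply/funext => i; exact: rnorm0.
have : rnorm a * rnorm (x i) + rnorm (y i) @[i --> \oo] --> (0 : R).
  rewrite -[X in _ --> X]addr0 -[X in _ --> X + _](mulr0 (rnorm a)).
  by apply: cvgD => //; exact: cvgMr.
apply: squeeze_cvgr; last exact: cvg_cst.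
by near=> i; rewrite rnorm_ge0/= -rnormZ; exact: rnormD.
Unshelve. all: by end_near. Qed.

HB.instance Definition _ := GRing.isSubmodClosed.Build _ _ c0_pred
  c0_submod_closed.
HB.instance Definition _ := [SubChoice_isSubLmodule of c0 by <:].

Definition c0_norm (x : c0) : R := sup (range (fun i => rnorm (x i))).

Lemma c0_has_sup (x : c0) : has_sup (range (fun i => rnorm (x i))).
Proof.
split; first by exists (rnorm (x 0%N)), 0%N.
have /cvg_seq_bounded : cvgn (fun i => rnorm (x i)).
  by apply/cvg_ex; exists 0; exact: c0P.
case=> M [_ /(_ (M + 1))]; rewrite ltrDl ltr01 => /(_ isT) bM.
exists (M + 1) => _ [i _ <-].
by rewrite (le_trans (ler_norm _))// bM.
Qed.

Lemma c0_norm_ub (x : c0) i : rnorm (x i) <= c0_norm x.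
Proof. by apply: ub_le_sup; [exact: (c0_has_sup x).2|exists i]. Qed.

Lemma c0_norm_le (x : c0) (M : R) :
  (forall i, rnorm (x i) <= M) -> c0_norm x <= M.
Proof.
move=> xM; apply: ge_sup; first exact: (c0_has_sup x).1.
by move=> _ [i _ <-].
Qed.

Lemma c0_normD x y : (c0_norm (x + y))%:C <= (c0_norm x)%:C + (c0_norm y)%:C.
Proof.
rewrite -rmorphD lecR; apply: c0_norm_le => i.
by rewrite (le_trans (rnormD _ _))// lerD// c0_norm_ub.
Qed.

Lemma c0_normZ (a : R[i]) x : (c0_norm (a *: x))%:C = `|a| * (c0_norm x)%:C.
Proof.
have le_normZ b y : c0_norm (b *: y) <= rnorm b * c0_norm y.
  apply: c0_norm_le => i.
  by rewrite rnormZ ler_wpM2l ?rnorm_ge0 ?c0_norm_ub.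
rewrite -rnormE -rmorphM/=; congr (_%:C); apply/eqP; rewrite eq_le le_normZ/=.
have [->|a0] := eqVneq a 0.
  by rewrite rnorm0 mul0r (le_trans (rnorm_ge0 _) (c0_norm_ub _ 0%N)).
have ra0 : 0 < rnorm a.
  by rewrite lt_neqAle rnorm_ge0 andbT eq_sym; apply: contra_neq a0 => /rnorm_eq0.
have := le_normZ a^-1 (a *: x); rewrite scalerA mulVf// scale1r.
rewrite -(ler_pM2l ra0) mulrA.
suff -> : rnorm a * rnorm a^-1 = 1 by rewrite mul1r.
by apply: complexI; rewrite rmorphM/= !rnormE -normrM mulfV// normr1.
Qed.

Lemma c0_norm_eq0 x : (c0_norm x)%:C = 0 -> x = 0.
Proof.
move=> /(@complexI _ _ 0) x0; apply/val_inj/funext => i; apply: rnorm_eq0.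
by apply/eqP; rewrite eq_le rnorm_ge0 andbT -x0 c0_norm_ub.
Qed.

HB.instance Definition _ := @Lmodule_isNormed.Build R[i] c0
  (fun x => (c0_norm x)%:C) c0_normD c0_normZ c0_norm_eq0.

Lemma rnorm_c0E (x : c0) : rnorm x = sup (range (fun i => rnorm (x i))).
Proof. by []. Qed.

End c0.

Section bilinear_forms.
Context {R : realType} {Z W : normedModType R[i]}.

Definition bilform_values (T : Z -> W -> R[i]) : set R :=
  [set r | exists z w, [/\ rnorm z <= 1, rnorm w <= 1 & r = rnorm (T z w)]].

Definition bilform_bounded (T : Z -> W -> R[i]) : Prop :=
  has_ubound (bilform_values T).

Definition bilform_norm (T : Z -> W -> R[i]) : R := sup (bilform_values T).

End bilinear_forms.

(* The unit sphere of the space of bounded bilinear forms on Z * W. *)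
Definition bilform_sphere (R : realType) (Z W : normedModType R[i])
    (T : {bilinear Z -> W -> R[i] | *%R & *%R}) : Prop :=
  bilform_bounded T /\ bilform_norm T = 1.

Definition property_Lpp (R : realType) (Z W : normedModType R[i]) : Prop :=
  forall (eps : R) (x0 : Z) (y0 : W), 0 < eps ->
    unit_sphere x0 -> unit_sphere y0 ->
    exists eta : R, 0 < eta /\
      forall T : {bilinear Z -> W -> R[i] | *%R & *%R},
        bilform_sphere T -> 1 - eta < rnorm (T x0 y0) ->
        exists S : {bilinear Z -> W -> R[i] | *%R & *%R},
          [/\ bilform_sphere S,
              rnorm (S x0 y0) = 1 &
              bilform_norm (fun z w => S z w - T z w) < eps].

(* Main.v *)
Require Import Defs.
From HB Require Import structures.
From mathcomp Require Import all_boot all_order all_algebra.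
From mathcomp Require Import all_classical all_reals all_analysis.
From mathcomp Require Import complex.
From mathcomp Require Import ring lra.

(* If u' = (u + t h) / |u + t h| and U is an isometry near the identity with  *)
(* U u' = u, then for f norming u the functional f \o U norms u' and is near  *)
(* f; hence a micro-transitive X is uniformly smooth. Micro-transitivity also *)
(* makes the isometries transitive on the sphere, so if X were not uniformly  *)
(* convex, every slice of the ball would have diameter > eps. Perturbing      *)
(* functionals, one could then choose inductively points u_n of the ball such *)
(* that, for every n, the convex hull of u_0, ..., u_n stays at a fixed       *)
(* distance from that of the later points; James' argument refutes this       *)
(* because the dual is uniformly convex.                                      *)
(*                                                                            *)
(* Let A and B be the finite sets of coordinates where x0 and y0 have norm 1. *)
(* If T nearly attains its norm at (x0, y0), then T is close to its (A, B)    *)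
(* block: x0 and y0 can be perturbed outside A and B, and for the mixed       *)
(* blocks smoothness forces T(., y0 + l y) to be almost a real multiple of a  *)
(* norming functional on each coordinate in A for every unimodular l, so      *)
(* T(., y) almost vanishes. On finite sums of copies of X, Lindenstrauss'     *)
(* iteration T + sum_n c_n F_n (x) G_n, whose functionals F_n and G_n expose  *)
(* by uniform convexity, yields a form close to T attaining its norm at a     *)
(* point near (x0, y0), and coordinatewise isometries move that point to      *)
(* (x0, y0).                                                                  *)

Set Implicit Arguments.
Unset Strict Implicit.
Unset Printing Implicit Defensive.

Import Order.TTheory GRing.Theory Num.Theory.
Import numFieldNormedType.Exports.

Local Open Scope classical_set_scope.
Local Open Scope ring_scope.
Local Open Scope complex_scope.

(** * Hahn-Banach and norming functionals *)

(** Micro-transitivity serves twice: it controls the geometry of X, and it moves points inside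
    finite blocks of coordinates. For the geometry, [micro_transitive_smooth] differentiates the
    norm uniformly, and [uniformly_smooth_dual] turns this into a uniform convexity property of the
    dual ball. By [micro_transitive_transitive] all unit vectors look alike, so a failure of uniform
    convexity anywhere makes all slices wide ([exposed_or_wide]). Wide slices yield a separated
    sequence ([wide_separated_sequence]), which [smooth_no_separated_sequence] excludes. Hence
    norming functionals expose their points with a common modulus ([micro_transitive_exposed]).

    Only finitely many coordinates of [x0] and of [y0] have norm 1, and the other norms stay below a
    constant less than 1. This gap, which depends on the points, gives the room for perturbation in
    [block_close]: a form nearly attaining its norm at [(x0, y0)] is close to its block on those
    coordinates. [finite_sum_attains] then corrects the block by Lindenstrauss' method followed by
    isometries. The corrected form sees the block coordinates only, and restriction to them does not
    increase norms, so its norm is again 1. *)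

Section hahn_banach.
Context {R : realType} {V : lmodType R}.

Definition sublinear (q : V -> R) :=
  (forall x y, q (x + y) <= q x + q y) /\
  (forall a x, 0 <= a -> q (a *: x) = a * q x).

Definition is_convex (D : set V) :=
  forall a b d e, 0 <= a -> 0 <= b -> a + b = 1 -> D d -> D e ->
  D (a *: d + b *: e).

Definition shift_values (q : V -> R) (D : set V) (c : R) (x : V) : set R :=
  [set r | exists d l, [/\ D d, 0 <= l & r = q (x + l *: d) - l * c]].

(** For convex nonempty [D] with [c <= q] on it, this is the largest sublinear functional below [q]
    that is at most [- c] on the opposites of points of [D]. A linear functional below it is
    therefore at least [c] on [D]. *)
Definition shift (q : V -> R) (D : set V) (c : R) (x : V) : R :=
  inf (shift_values q D c x).

Lemma sublinear0 q : sublinear q -> q 0 = 0.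
Proof. by case=> _ /(_ 0 0 (lexx _)); rewrite scale0r mul0r. Qed.

Lemma sublinear_oppr q x : sublinear q -> - q (- x) <= q x.
Proof.
move=> sq; rewrite lerNl -subr_ge0 opprK.
by rewrite -(sublinear0 sq) -(subrr x) addrC sq.1.
Qed.

Section shift.
Context (q : V -> R) (D : set V) (c : R) (d0 : V).
Hypotheses (sq : sublinear q) (cD : is_convex D) (Dd0 : D d0).
Hypothesis qD : forall d, D d -> c <= q d.

Let lb x : lbound (shift_values q D c x) (- q (- x)).
Proof.
move=> _ [d [l [Dd l0 ->]]].
have := sq.1 (x + l *: d) (- x); rewrite {1}(addrC x) addrK sq.2//.
by have := ler_wpM2l l0 (qD Dd); lra.
Qed.

Let nonempty x : shift_values q D c x !=set0.
Proof. by exists (q (x + 0 *: d0) - 0 * c), d0, 0. Qed.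

Lemma shift_le x d l : D d -> 0 <= l -> shift q D c x <= q (x + l *: d) - l * c.
Proof. by move=> Dd l0; apply: ge_inf; [exists (- q (- x))|exists d, l]. Qed.

Lemma le_shift x r :
  (forall d l, D d -> 0 <= l -> r <= q (x + l *: d) - l * c) ->
  r <= shift q D c x.
Proof. by move=> h; apply: lb_le_inf => // _ [d [l [Dd l0 ->]]]; exact: h. Qed.

Lemma shift_le_id x : shift q D c x <= q x.
Proof.
by have := @shift_le x d0 0 Dd0 (lexx _); rewrite scale0r addr0 mul0r subr0.
Qed.

Lemma shift_opp d : D d -> shift q D c (- d) <= - c.
Proof.
move=> Dd; have := @shift_le (- d) d 1 Dd ler01.
by rewrite scale1r [- d + d]addrC subrr sublinear0// mul1r add0r.
Qed.

(** Convexity merges [l *: d + m *: e] into [l + m] times a single point of [D]; the weights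
    degenerate only when [l = m = 0]. *)
Let shift_combine x y d e l m : D d -> D e -> 0 <= l -> 0 <= m ->
  shift q D c (x + y) <= (q (x + l *: d) - l * c) + (q (y + m *: e) - m * c).
Proof.
move=> Dd De l0 m0; have [lm0|lm0] := eqVneq (l + m) 0.
  have [-> ->] : l = 0 /\ m = 0 by split; lra.
  rewrite !scale0r !addr0 !mul0r !subr0 (le_trans _ (sq.1 _ _))//.
  exact: shift_le_id.
have lm : 0 < l + m by rewrite lt_neqAle eq_sym lm0 addr_ge0.
have Dde : D ((l / (l + m)) *: d + (m / (l + m)) *: e).
  by apply: cD => //; rewrite -?mulrDl ?divff// divr_ge0// ltW.
apply: (le_trans (shift_le (x + y) Dde (ltW lm))).
rewrite scalerDr !scalerA !mulrA ![(l + m) * _]mulrC !mulfK// addrACA.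
by have := sq.1 (x + l *: d) (y + m *: e); lra.
Qed.

Lemma shift_sublinear : sublinear (shift q D c).
Proof.
have shiftZ a x : 0 < a -> shift q D c (a *: x) <= a * shift q D c x.
  move=> a0; rewrite mulrC -ler_pdivrMr//; apply: le_shift => d l Dd l0.
  rewrite ler_pdivrMr// [leRHS]mulrC mulrBr -sq.2 ?(ltW a0)// scalerDr scalerA mulrA.
  by apply: shift_le => //; rewrite mulr_ge0// ltW.
split=> [x y|a x].
  rewrite -lerBlDr; apply: le_shift => d l Dd l0.
  rewrite lerBlDr [leRHS]addrC -lerBlDr; apply: le_shift => e m De m0.
  by rewrite lerBlDr [leRHS]addrC; exact: shift_combine.
rewrite le_eqVlt => /predU1P[<-|a0]; last first.
  apply/le_anti/andP; split; first exact: shiftZ.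
  rewrite -ler_pdivlMl// -{1}(scale1r x) -(mulVf (lt0r_neq0 a0)) -scalerA.
  by apply: shiftZ; rewrite invr_gt0.
rewrite scale0r mul0r; apply/le_anti/andP; split.
  by rewrite (le_trans (shift_le_id 0))// sublinear0.
apply: le_shift => d l Dd l0; rewrite add0r sq.2// -mulrBr.
by rewrite mulr_ge0// subr_ge0 qD.
Qed.

End shift.

(* A minimal element among the sublinear functionals below p is linear: it is *)
(* not lowered by the shift along the singleton {x}.                          *)
Lemma hahn_banach (p : V -> R) : sublinear p ->
  exists2 f : V -> R, scalar f & forall x, f x <= p x.
Proof.
move=> sp; pose T := {q : V -> R | sublinear q /\ forall x, q x <= p x}.
(* The order is reversed, so that a maximal element given by [Zorn] is a minimal functional; a chain
   is bounded by its pointwise infimum. *)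
pose below (q r : T) := `[< forall x, sval r x <= sval q x >].
have [||||[f [sf fp]] fmin] := @Zorn T below.
- by move=> q; apply/asboolP.
- move=> q r s /asboolP qr /asboolP rs; apply/asboolP => x.
  exact: le_trans (rs x) (qr x).
- move=> [q Pq] [r Pr] /asboolP/= qr /asboolP/= rq; apply: eq_exist.
  by apply/funext => x; apply/le_anti/andP.
- move=> A totA; have [A0|/set0P[q0 Aq0]] := eqVneq A set0.
    by exists (exist _ p (conj sp (fun x => lexx _))) => s; rewrite A0.
  pose B x := [set sval q x | q in A].
  have lbB x : has_lbound (B x).
    exists (- p (- x)) => _ [[q [sq qp]] Aq <-] /=.
    by rewrite (le_trans _ (sublinear_oppr x sq))// lerN2 qp.
  have infB x q : A q -> inf (B x) <= sval q x.
    by move=> Aq; apply: ge_inf => //; exists q.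
  have geB x r : (forall q, A q -> r <= sval q x) -> r <= inf (B x).
    move=> h; apply: lb_le_inf; first by exists (sval q0 x), q0.
    by move=> _ [q Aq <-]; exact: h.
  have sB : sublinear (fun x => inf (B x)).
    split=> [x y|a x a0].
      rewrite -lerBlDr; apply: (geB) => q Aq.
      rewrite lerBlDr [leRHS]addrC -lerBlDr; apply: (geB) => r Ar; rewrite lerBlDr.
      have [/asboolP qr|/asboolP rq] := totA _ _ Aq Ar.
        rewrite (le_trans (infB _ _ Ar))// (le_trans ((svalP r).1.1 _ _))//.
        by rewrite addrC lerD2l.
      rewrite (le_trans (infB _ _ Aq))// (le_trans ((svalP q).1.1 _ _))//.
      by rewrite addrC lerD2r.
    apply/le_anti/andP; split.
      have [->|an0] := eqVneq a 0.
        rewrite mul0r scale0r (le_trans (infB _ _ Aq0))//.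
        by rewrite (sublinear0 (svalP q0).1).
      have ap : 0 < a by rewrite lt_neqAle eq_sym an0.
      rewrite -ler_pdivrMl//; apply: (geB) => q Aq; rewrite ler_pdivrMl//.
      by rewrite -((svalP q).1.2)// infB.
    apply: (geB) => q Aq; rewrite ((svalP q).1.2)//.
    by rewrite ler_wpM2l// infB.
  have Bp x : inf (B x) <= p x.
    by rewrite (le_trans (infB _ _ Aq0))// (svalP q0).2.
  exists (exist _ (fun x => inf (B x)) (conj sB Bp)) => q Aq.
  by apply/asboolP => x /=; exact: infB.
exists f => //.
have fN x : f (- x) = - f x.
  have cx : is_convex [set x].
    by move=> a b _ _ _ _ ab -> ->; rewrite -scalerDl ab scale1r.
  have le_fx d : [set x] d -> f x <= f d by move=> ->.
  have sg := shift_sublinear sf cx erefl le_fx.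
  have gf y : shift f [set x] (f x) y <= f y.
    by apply: (@shift_le_id _ _ _ x) => //.
  have gp y : shift f [set x] (f x) y <= p y by exact: le_trans (fp y).
  have /(congr1 (fun h : T => sval h (- x)))/= fE :
    exist _ _ (conj sg gp) = exist _ f (conj sf fp) :> T by apply: fmin; exact/asboolP.
  apply/le_anti/andP; split.
    by rewrite -fE; exact: (shift_opp sf le_fx).
  by rewrite -{1}(opprK x); exact: sublinear_oppr.
have fZ a x : f (a *: x) = a * f x.
  have [a0|a0] := leP 0 a; first exact: sf.2.
  rewrite -{1}(opprK a) scaleNr fN sf.2 ?oppr_ge0 ?ltW//.
  by rewrite mulNr opprK.
move=> a x y; rewrite -fZ; apply/le_anti; rewrite sf.1/=.
rewrite -lerBrDr -fN (le_trans _ (sf.1 _ _))//.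
by rewrite addrK.
Qed.

End hahn_banach.

Section real_parts.
Context {R : realType}.

Lemma rnormN (V : normedZmodType R[i]) (x : V) : rnorm (- x) = rnorm x.
Proof. by rewrite /rnorm normrN. Qed.

Lemma rnormBC (V : normedZmodType R[i]) (x y : V) : rnorm (x - y) = rnorm (y - x).
Proof. by rewrite /rnorm distrC. Qed.

Lemma rnormB_le (V : normedZmodType R[i]) (x y : V) :
  rnorm x - rnorm y <= rnorm (x - y).
Proof. by rewrite lerBlDr -{1}(subrK y x) rnormD. Qed.

Lemma rnorm_triangle (V : normedZmodType R[i]) (x y z : V) :
  rnorm (x - z) <= rnorm (x - y) + rnorm (y - z).
Proof. by rewrite (le_trans _ (rnormD _ _))// addrA subrK. Qed.

Lemma rnorm_real (a : R) : rnorm a%:C = `|a|.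
Proof. by apply: complexI; rewrite rnormE normc_def/= expr0n addr0 sqrtr_sqr. Qed.

Lemma rnormZr (V : normedModType R[i]) (a : R) (x : V) :
  rnorm (a%:C *: x) = `|a| * rnorm x.
Proof. by rewrite rnormZ rnorm_real. Qed.

Lemma rnorm1 : rnorm (1 : R[i]) = 1.
Proof. by rewrite (rnorm_real 1) normr1. Qed.

Lemma rnormM (a b : R[i]) : rnorm (a * b) = rnorm a * rnorm b.
Proof. exact: (@rnormZ _ R[i]^o). Qed.

Lemma rnormi : rnorm ('i : R[i]) = 1.
Proof.
by apply: complexI; rewrite rnormE normc_def/= expr0n expr1n add0r sqrtr1.
Qed.

Lemma normRe_le_rnorm (z : R[i]) : `|complex.Re z| <= rnorm z.
Proof. by rewrite -lecR rnormE normc_ge_Re. Qed.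

Lemma Re_le_rnorm (z : R[i]) : complex.Re z <= rnorm z.
Proof. exact: le_trans (ler_norm _) (normRe_le_rnorm z). Qed.

Lemma ReD (z w : R[i]) : complex.Re (z + w) = complex.Re z + complex.Re w.
Proof. by case: z w => [a b] [c d]. Qed.

Lemma ReN (z : R[i]) : complex.Re (- z) = - complex.Re z.
Proof. by case: z => [a b]. Qed.

Lemma ReB (z w : R[i]) : complex.Re (z - w) = complex.Re z - complex.Re w.
Proof. by rewrite ReD ReN. Qed.

Lemma ReZ (a : R) (w : R[i]) : complex.Re (a%:C * w) = a * complex.Re w.
Proof. by case: w => [c d] /=; rewrite mul0r subr0. Qed.

Lemma Re_unit (z : R[i]) : rnorm z <= 1 -> complex.Re z = 1 -> z = 1.
Proof.
case: z => a b; rewrite -lecR rnormE normc_def/= lecR => + a1; rewrite a1 => h.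
have := h; rewrite -[leRHS]sqrtr1 ler_sqrt// expr1n gerDl => b0.
have : b ^+ 2 == 0 by rewrite eq_le b0 sqr_ge0.
by rewrite sqrf_eq0 => /eqP ->.
Qed.

Lemma phase (z : R[i]) : exists2 k : R[i], rnorm k = 1 & k * z = (rnorm z)%:C.
Proof.
have [->|z0] := eqVneq z 0; first by exists 1; rewrite ?rnorm1// mulr0 rnorm0.
have nz : rnorm z != 0 by apply: contra_neq z0 => /rnorm_eq0.
exists ((rnorm z)%:C / z).
  rewrite rnormM rnorm_real ger0_norm ?rnorm_ge0//.
  by apply: (mulIf nz); rewrite -mulrA -rnormM mulVf// rnorm1 mulr1 mul1r.
by rewrite mulfVK.
Qed.

Lemma conj_phase (k : R[i]) : rnorm k = 1 -> exists2 l, rnorm l = 1 & k * l = 1.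
Proof.
move=> k1; have [l l1 lk] := phase k; exists l => //.
by rewrite mulrC lk k1.
Qed.

Lemma rnorm_le_Re (z : R[i]) (c : R) :
  (forall k : R[i], rnorm k = 1 -> complex.Re (k * z) <= c) -> rnorm z <= c.
Proof. by move=> h; have [k k1 kz] := phase z; have := h k k1; rewrite kz. Qed.

End real_parts.

Section scalar.
Context {K : nzRingType} {V : lmodType K} (f : V -> K).
Hypothesis lf : scalar f.

Lemma scalarD x y : f (x + y) = f x + f y.
Proof. by rewrite -{1}(scale1r x) lf mul1r. Qed.

Lemma scalar0 : f 0 = 0.
Proof. by apply: (addIr (f 0)); rewrite -scalarD !add0r. Qed.

Lemma scalarZ a x : f (a *: x) = a * f x.
Proof. by rewrite -{1}(addr0 (a *: x)) lf scalar0 addr0. Qed.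

Lemma scalarN x : f (- x) = - f x.
Proof. by rewrite -scaleN1r scalarZ mulN1r. Qed.

Lemma scalarB x y : f (x - y) = f x - f y.
Proof. by rewrite scalarD scalarN. Qed.

Lemma scalar_sum I (r : seq I) (P : pred I) (F : I -> V) :
  f (\sum_(i <- r | P i) F i) = \sum_(i <- r | P i) f (F i).
Proof. exact: (big_morph f scalarD scalar0). Qed.

End scalar.

(** A synonym of X that carries the real scalar multiplication, so that the real Hahn-Banach theorem
    applies to it. *)
Definition realify (R : realType) (X : lmodType R[i]) : Type := X.

Section realify.
Context {R : realType} (X : lmodType R[i]).

HB.instance Definition _ := GRing.Zmodule.on (realify X).

Let realify_scale (a : R) (x : realify X) : realify X := a%:C *: (x : X).

Let scaleA a b x :
  realify_scale a (realify_scale b x) = realify_scale (a * b) x.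
Proof. by rewrite /realify_scale scalerA rmorphM. Qed.

Let scale1 : left_id 1 realify_scale.
Proof. by move=> x; exact: scale1r. Qed.

Let scaleDr : right_distributive realify_scale +%R.
Proof. by move=> a x y; exact: scalerDr. Qed.

Let scaleDl x : {morph realify_scale^~ x : a b / a + b}.
Proof. by move=> a b; rewrite /realify_scale rmorphD/= scalerDl. Qed.

HB.instance Definition _ := GRing.Zmodule_isLmodule.Build R (realify X)
  scaleA scale1 scaleDr scaleDl.

Definition real_linear (g : X -> R) := scalar (g : realify X -> R).

Section real_linear.
Context (g : X -> R).
Hypothesis lg : real_linear g.

Lemma real_linearD (x y : X) : g (x + y) = g x + g y.
Proof. exact: (@scalarD _ _ _ lg). Qed.

Lemma real_linear0 : g 0 = 0. Proof. exact: (@scalar0 _ _ _ lg). Qed.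

Lemma real_linearN (x : X) : g (- x) = - g x.
Proof. exact: (@scalarN _ _ _ lg). Qed.

Lemma real_linearB (x y : X) : g (x - y) = g x - g y.
Proof. exact: (@scalarB _ _ _ lg). Qed.

Lemma real_linearZ (a : R) (x : X) : g (a%:C *: x) = a * g x.
Proof. exact: (@scalarZ _ _ _ lg a x). Qed.

End real_linear.

Lemma real_linearP (g : X -> R) :
  (forall (a : R) x y, g (a%:C *: x + y) = a * g x + g y) -> real_linear g.
Proof. by []. Qed.

Lemma real_linear_comb (a b : R) (g h : X -> R) : real_linear g ->
  real_linear h -> real_linear (fun x => a * g x + b * h x).
Proof.
move=> lg lh; apply: real_linearP => c x y.
by rewrite !real_linearD// !real_linearZ//; ring.
Qed.

Lemma real_linear_Re (f : X -> R[i]) : scalar f ->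
  real_linear (fun x => complex.Re (f x)).
Proof. by move=> lf; apply: real_linearP => a x y; rewrite lf ReD ReZ. Qed.

(** The complex-linear functional with real part [g], namely g(x) - i g(ix). *)
Definition complexify (g : X -> R) (x : X) : R[i] := g x +i* - g ('i *: x).

Lemma complexify_scalar g : real_linear g -> scalar (complexify g).
Proof.
move=> lg [a b] x y; rewrite /complexify.
have e : (a +i* b) *: x = a%:C *: x + b%:C *: ('i *: x).
  rewrite scalerA -scalerDl; congr (_ *: _).
  by rewrite /real_complex_def; simpc.
have e' : 'i *: ((a +i* b) *: x) = a%:C *: ('i *: x) + (- b)%:C *: x.
  rewrite !scalerA -scalerDl; congr (_ *: _).
  by rewrite /real_complex_def; simpc.
rewrite scalerDr e' e !real_linearD// !real_linearZ//.
by simpc; congr (_ +i* _); ring.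
Qed.

End realify.

Section norming.
Context {R : realType} {X : normedModType R[i]}.
Implicit Types (x u h : X) (g : X -> R).

(** The unit ball of the real dual. The one-sided bound controls [|g x|], since [x] may be replaced
    by [- x]. *)
Definition ball1 g := real_linear g /\ forall x, g x <= rnorm x.

Lemma ball1_norm g x : ball1 g -> `|g x| <= rnorm x.
Proof.
move=> [lg gN]; rewrite ler_norml gN andbT lerNl -real_linearN//.
by rewrite -rnormN gN.
Qed.

(** Hahn-Banach below the shift of the norm along [D]: the functional obtained is below the norm,
    and at most [- c] at each [- d]. *)
Lemma separation (D : set X) (c : R) d0 : D d0 ->
  (forall (a b : R) d e, 0 <= a -> 0 <= b -> a + b = 1 -> D d -> D e ->
    D (a%:C *: d + b%:C *: e)) ->
  (forall d, D d -> c <= rnorm d) ->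
  exists2 g, ball1 g & forall d, D d -> c <= g d.
Proof.
move=> Dd0 cD Dc; pose q (x : realify X) := rnorm (x : X).
have sq : sublinear q.
  split=> [x y|a x a0]; first exact: rnormD.
  by rewrite /q rnormZr ger0_norm.
have sg := shift_sublinear sq cD Dd0 Dc.
have [g lg gle] := hahn_banach sg; exists g.
  split=> // x; apply: le_trans (gle x) _.
  exact: (shift_le_id sq Dd0 Dc).
move=> d Dd; rewrite -lerN2 -(real_linearN lg) (le_trans (gle _))//.
exact: (shift_opp sq Dc).
Qed.

Lemma norming_real u : exists2 g, ball1 g & g u = rnorm u.
Proof.
have [//|a b _ _ _ _ ab -> ->|_ ->//|g g1 gu] := @separation [set u] (rnorm u) u.
  by rewrite /= -scalerDl -rmorphD ab scale1r.
by exists g => //; apply/le_anti; rewrite gu// g1.2.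
Qed.

Lemma norming u : rnorm u = 1 -> exists f : X -> R[i],
  [/\ scalar f, forall x, rnorm (f x) <= rnorm x & f u = 1].
Proof.
move=> u1; have [g g1 gu] := norming_real u; exists (complexify g).
have lf := complexify_scalar g1.1.
have le_f x : rnorm (complexify g x) <= rnorm x.
  apply: rnorm_le_Re => k k1; rewrite -scalarZ//=.
  by rewrite (le_trans (g1.2 _))// rnormZ k1 mul1r.
by split=> //; apply: Re_unit; rewrite -u1.
Qed.

Lemma ball1_Re (f : X -> R[i]) : scalar f -> (forall x, rnorm (f x) <= rnorm x) ->
  ball1 (fun x => complex.Re (f x)).
Proof.
move=> lf fN; split; first exact: real_linear_Re.
by move=> x; rewrite (le_trans (Re_le_rnorm _)).
Qed.

End norming.

(** * Uniform smoothness and transitivity *)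

Section smoothness.
Context {R : realType} {X : normedModType R[i]}.
Implicit Types (x u h : X) (g : X -> R).

(** A first-order upper expansion of the norm at unit vectors, uniform in the point, in the
    direction and in the norming functional, which acts as the derivative. *)
Definition uniformly_smooth := forall eps : R, 0 < eps ->
  exists2 tau : R, 0 < tau & forall u g h (t : R), rnorm u = 1 -> ball1 g ->
    g u = 1 -> 0 <= t <= tau -> rnorm h <= 1 ->
    rnorm (u + t%:C *: h) <= 1 + t * g h + eps * t.

Definition isometry (U : X -> X) :=
  (forall (a : R[i]) x y, U (a *: x + y) = a *: U x + U y) /\
  forall x, rnorm (U x) = rnorm x.

Lemma opnorm_bound (f : X -> X) (c d : R) :
  (forall (a : R[i]) x, f (a *: x) = a *: f x) ->
  (forall x, rnorm (f x) <= d * rnorm x) -> opnorm f < c ->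
  forall x, rnorm (f x) <= c * rnorm x.
Proof.
move=> fZ fd fc x; have [->|x0] := eqVneq x 0.
  by rewrite -{1}(scale0r 0) fZ scale0r !rnorm0 mulr0.
have nx : 0 < rnorm x.
  by rewrite lt_neqAle rnorm_ge0 andbT eq_sym; apply: contra_neq x0 => /rnorm_eq0.
rewrite -ler_pdivrMr// mulrC -[(rnorm x)^-1]ger0_norm ?invr_ge0 ?rnorm_ge0//.
rewrite -rnormZr -fZ (le_trans _ (ltW fc))//; apply: ub_le_sup.
  exists `|d| => _ [z /= z1 <-]; apply: le_trans (fd z) _.
  rewrite (le_trans (ler_wpM2r (rnorm_ge0 _) (ler_norm d)))//.
  by rewrite ler_piMr.
exists ((rnorm x)^-1%:C *: x) => //=.
by rewrite rnormZr ger0_norm ?invr_ge0 ?rnorm_ge0// mulVf// lt0r_neq0.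
Qed.

Lemma micro_transitive_isometry : micro_transitive X -> forall eps : R, 0 < eps ->
  exists2 theta : R, 0 < theta & forall x y, rnorm x = 1 -> rnorm y = 1 ->
    rnorm (x - y) < theta -> exists U, [/\ isometry U, U x = y &
      forall z, rnorm (U z - z) <= eps * rnorm z].
Proof.
move=> mX eps e0; have [theta [/andP[t0 _] tP]] := mX _ e0.
exists theta => // x y x1 y1 /(tP _ _ x1 y1) [U [UN Uxy Ueps]].
exists U; split=> //; first by split=> // a u v; rewrite linearP.
(* An isometry differs from the identity by at most 2, so the supremum in [opnorm] is taken over a
   bounded set and bounds each value. *)
apply: (@opnorm_bound _ _ 2) => [a z|z|//].
  by rewrite linearZ scalerBr.
by rewrite (le_trans (rnormD _ _))// rnormN UN; lra.
Qed.

Lemma isometryZr U (a : R) x : isometry U -> U (a%:C *: x) = a%:C *: U x.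
Proof.
case=> UL _; have U0 : U 0 = 0.
  by apply: (addIr (U 0)); have := UL 1 0 0; rewrite !scale1r !add0r.
by have := UL a%:C x 0; rewrite U0 !addr0.
Qed.

Lemma isometryD U x y : isometry U -> U (x + y) = U x + U y.
Proof. by case=> UL _; have := UL 1 x y; rewrite !scale1r. Qed.

Lemma isometryB U x y : isometry U -> U (x - y) = U x - U y.
Proof. by move=> IU; apply: (addIr (U y)); rewrite -isometryD// !subrK. Qed.

Lemma isometry_comp U V : isometry U -> isometry V -> isometry (U \o V).
Proof.
move=> [UL UN] [VL VN]; split=> [a x y|x] /=; first by rewrite VL UL.
by rewrite UN VN.
Qed.

Lemma ball1_isometry U g : isometry U -> ball1 g -> ball1 (g \o U).
Proof.
move=> IU [lg gN]; split=> [|x] /=; last by rewrite -IU.2 gN.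
by apply: real_linearP => a x y /=; rewrite IU.1 real_linearD// real_linearZ.
Qed.

(* With U u' = u for u' = (u + t h) / |u + t h|, the functional g \o U norms *)
(* u' and is close to g.                                                     *)
Lemma micro_transitive_smooth : micro_transitive X -> uniformly_smooth.
Proof.
move=> mX eps e0; have [theta th0 thP] := micro_transitive_isometry mX e0.
(* [t <= 1/2] keeps [u + t h] away from 0, and [t <= theta / 8] puts its normalization within
   [2 t < theta] of [u]. *)
pose tau := Num.min (theta / 8) 2^-1.
exists tau; first by rewrite lt_min; apply/andP; split; lra.
move=> u g h t u1 g1 gu /andP[t0 tle] h1.
have [tth t2] : t <= theta / 8 /\ t <= 2^-1.
  by split; rewrite (le_trans tle)// /tau ge_min lexx ?orbT.
set v := u + t%:C *: h.
have th1 : rnorm (t%:C *: h) <= t by rewrite rnormZr ger0_norm// ler_piMr.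
have vle : rnorm v <= 1 + t by rewrite (le_trans (rnormD _ _))// u1 lerD2l.
have vge : 1 - t <= rnorm v.
  by rewrite -u1 lerBlDr -(addrK (t%:C *: h) u) (le_trans (rnormD _ _))//
    rnormN lerD2l.
have v0 : 0 < rnorm v by lra.
pose w := (rnorm v)^-1%:C *: v.
have vw : v = (rnorm v)%:C *: w.
  by rewrite /w scalerA -rmorphM mulfV ?lt0r_neq0// scale1r.
have w1 : rnorm w = 1.
  by rewrite /w rnormZr ger0_norm ?invr_ge0 ?ltW// mulVf// lt0r_neq0.
have wu : rnorm (w - u) < theta.
  have -> : w - u = (v - u) - (rnorm v - 1)%:C *: w.
    rewrite rmorphB/= scalerBl -vw scale1r opprB.
    by rewrite [RHS]addrC addrA subrK.
  have := rnormD (v - u) (- ((rnorm v - 1)%:C *: w)).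
  have vu : v - u = t%:C *: h by rewrite /v [u + _]addrC addrK.
  rewrite rnormN [rnorm (_ *: w)]rnormZr w1 mulr1 {2}vu => le1.
  have le2 : `|rnorm v - 1| <= t by rewrite ler_norml; apply/andP; split; lra.
  by rewrite (le_lt_trans le1)//; lra.
have [U [IU Uwu Ueps]] := thP _ _ w1 u1 wu.
have gUv : g (U v) = rnorm v.
  by rewrite {1}vw isometryZr// Uwu (real_linearZ g1.1) gu mulr1.
rewrite -gUv /v isometryD// isometryZr// real_linearD ?real_linearZ; try exact: g1.1.
have gUu : g (U u) <= 1 by rewrite (le_trans (g1.2 _))// IU.2 u1.
have : g (U h) - g h <= eps.
  rewrite -real_linearB ?(le_trans (g1.2 _))//; last exact: g1.1.
  by rewrite (le_trans (Ueps _))// ler_piMr// ltW.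
move=> /(ler_wpM2l t0); lra.
Qed.

(** Let [f] norm the direction [v] of [u]. A functional [k] almost norming [v] satisfies [k v + tau
    * k x <= |v + tau x| <= 1 + tau * f x + (eps / 8) * tau], so [k x - f x] is at most
    [delta / tau + eps / 8]. Both [g] and [h] are thus close to the same [f]. *)
Lemma uniformly_smooth_dual : uniformly_smooth -> forall eps : R, 0 < eps ->
  exists2 delta : R, 0 < delta & forall u (g h : X -> R), rnorm u <= 1 -> ball1 g ->
    ball1 h -> 1 - delta < g u -> 1 - delta < h u ->
    forall x, `|g x - h x| <= eps * rnorm x.
Proof.
move=> sX eps e0; have [tau t0 tP] := sX (eps / 8) ltac:(lra).
pose delta := Num.min (eps * tau / 16) (2^-1 : R).
have et : 0 < eps * tau by rewrite mulr_gt0.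
exists delta; first by rewrite lt_min; apply/andP; split; lra.
move=> u g h u1 g1 h1 gu hu.
have [d1 d2] : delta <= eps * tau / 16 /\ delta <= 2^-1.
  by split; rewrite /delta ge_min lexx ?orbT.
have u0 : 0 < rnorm u by have := g1.2 u; lra.
pose v := (rnorm u)^-1%:C *: u.
have v1 : rnorm v = 1.
  by rewrite /v rnormZr ger0_norm ?invr_ge0 ?ltW// mulVf// lt0r_neq0.
have vbig k : ball1 k -> 1 - delta < k u -> 1 - delta < k v.
  move=> k1 ku; rewrite /v real_linearZ ?(lt_le_trans ku)//; last exact: k1.1.
  by rewrite ler_peMl ?invf_ge1//; lra.
have [f f1 fv] := norming_real v; rewrite v1 in fv.
have half k x : ball1 k -> 1 - delta < k u -> rnorm x <= 1 ->
    k x - f x <= eps / 4.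
  move=> k1 /(vbig _ k1) kv x1.
  have tt : 0 <= tau <= tau by rewrite lexx ltW.
  have := le_trans (k1.2 _) (tP v f x tau v1 f1 fv tt x1).
  rewrite (real_linearD k1.1) (real_linearZ k1.1 tau) => le1.
  by rewrite -(ler_pM2l t0); lra.
have halfN k x : ball1 k -> 1 - delta < k u -> rnorm x <= 1 ->
    `|k x - f x| <= eps / 4.
  move=> k1 ku x1; rewrite ler_norml half// andbT.
  have := half k (- x) k1 ku; rewrite rnormN => /(_ x1).
  by rewrite (real_linearN k1.1) (real_linearN f1.1); lra.
have unit x : rnorm x <= 1 -> `|g x - h x| <= eps.
  move=> x1; have := halfN g x g1 gu x1; have := halfN h x h1 hu x1.
  rewrite !ler_norml => /andP[a1 a2] /andP[b1 b2].
  by apply/andP; split; lra.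
move=> x; have [->|x0] := eqVneq x 0.
  by rewrite (real_linear0 g1.1) (real_linear0 h1.1) subrr normr0 rnorm0 mulr0.
have nx : 0 < rnorm x.
  by rewrite lt_neqAle rnorm_ge0 andbT eq_sym; apply: contra_neq x0 => /rnorm_eq0.
have := unit ((rnorm x)^-1%:C *: x).
rewrite rnormZr ger0_norm ?invr_ge0 ?rnorm_ge0// mulVf ?lt0r_neq0// => /(_ (lexx _)).
rewrite (real_linearZ g1.1) (real_linearZ h1.1) -mulrBr normrM ger0_norm ?invr_ge0 ?rnorm_ge0//.
by rewrite ler_pdivrMl// mulrC.
Qed.

End smoothness.
Arguments uniformly_smooth {R} X.

Section normalization.
Context {R : realType} {X : normedModType R[i]}.
Implicit Types (x y u v : X).

Definition normalize x : X := (rnorm x)^-1%:C *: x.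

Lemma normalizeE x : 0 < rnorm x -> (rnorm x)%:C *: normalize x = x.
Proof.
by move=> x0; rewrite /normalize scalerA -rmorphM mulfV ?lt0r_neq0// scale1r.
Qed.

Lemma rnorm_normalize x : 0 < rnorm x -> rnorm (normalize x) = 1.
Proof.
move=> x0; rewrite /normalize rnormZr ger0_norm ?invr_ge0 ?ltW//.
by rewrite mulVf// lt0r_neq0.
Qed.

Lemma normalize_id x : rnorm x = 1 -> normalize x = x.
Proof. by move=> x1; rewrite /normalize x1 invr1 scale1r. Qed.

Lemma rnorm_gt0 x : x != 0 -> 0 < rnorm x.
Proof.
by move=> x0; rewrite lt_neqAle rnorm_ge0 andbT eq_sym;
  apply: contra_neq x0 => /rnorm_eq0.
Qed.

Lemma normalize_dist x y : 0 < rnorm x -> 0 < rnorm y ->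
  rnorm (normalize x - normalize y) <= 2 * rnorm (x - y) / rnorm x.
Proof.
move=> x0 y0.
have -> : normalize x - normalize y =
    (rnorm x)^-1%:C *: (x - y)
    + ((rnorm y - rnorm x) / rnorm x)%:C *: normalize y.
  rewrite scalerBr -addrA; congr (_ + _).
  have key (a b : R) (n z : X) : a != 0 -> b%:C *: n = z ->
      - n = - (a^-1%:C *: z) + ((b - a) / a)%:C *: n.
    move=> a0 <-; rewrite scalerA -rmorphM addrC -scalerBl -rmorphB/=.
    rewrite [X in X%:C](_ : _ = -1) ?rmorphN ?scaleN1r//.
    by field.
  by apply: key; rewrite ?normalizeE// lt0r_neq0.
apply: le_trans (rnormD _ _) _; rewrite rnormZr.
rewrite [X in _ + X](rnormZr _ (normalize y)) rnorm_normalize// mulr1.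
rewrite ger0_norm ?invr_ge0 ?(ltW x0)// normrM [`|_^-1|]ger0_norm ?invr_ge0 ?(ltW x0)//.
rewrite [_^-1 * _]mulrC -mulrDl ler_pM2r ?invr_gt0//.
have : `|rnorm y - rnorm x| <= rnorm (x - y).
  rewrite ler_norml; have := rnormB_le x y; have := rnormB_le y x.
  by rewrite [rnorm (y - x)]rnormBC => h1 h2; apply/andP; split; lra.
by lra.
Qed.

End normalization.

Section transitivity.
Context {R : realType} {X : normedModType R[i]}.
Implicit Types (x y u v : X).

Lemma isometry_id : isometry (@id X). Proof. by []. Qed.

Lemma isometry_opp : isometry (@GRing.opp X).
Proof. by split=> [a x y|x]; [rewrite opprD scalerN|exact: rnormN]. Qed.

(* The normalized segment from u to v stays away from 0 when 1 <= |u + v|; *)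
(* otherwise the segment from u to - v does.                                *)
Lemma micro_transitive_transitive : micro_transitive X -> forall u v,
  rnorm u = 1 -> rnorm v = 1 -> exists2 U, isometry U & U u = v.
Proof.
move=> mX; have [theta th0 thP] := micro_transitive_isometry mX ltr01.
have far u v : rnorm u = 1 -> rnorm v = 1 -> 1 <= rnorm (u + v) ->
    exists2 U, isometry U & U u = v.
  move=> u1 v1 uv; pose w (s : R) := u + s%:C *: (v - u).
  have wE s : w s = (1 - s)%:C *: u + s%:C *: v.
    by rewrite /w rmorphB scalerBl/= scale1r scalerBr addrA addrAC.
  have wdist s t : rnorm (w s - w t) <= 2 * `|s - t|.
    rewrite /w opprD addrACA subrr add0r -scalerBl -rmorphB rnormZr mulrC.
    by rewrite ler_wpM2r// (le_trans (rnormD _ _))// rnormN u1 v1.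
  (* For [s <= 1/2], the distance to [u] gives the lower bound [1 - 2 s], and [1 <= |u + v|] gives
     the lower bound [s]; they cross at [s = 1/3]. The other half is symmetric. *)
  have w3 s : 0 <= s <= 1 -> 3^-1 <= rnorm (w s).
    move=> /andP[s0 s1].
    have b1 : 1 - 2 * s <= rnorm (w s).
      have := wdist s 0; have := rnormB_le u (w s).
      rewrite rnormBC u1 [w 0]/w scale0r addr0 subr0 ger0_norm//.
      by lra.
    have b3 : 2 * s - 1 <= rnorm (w s).
      have := wdist s 1; have := rnormB_le v (w s).
      rewrite rnormBC v1 [w 1]/w scale1r subrKC ler0_norm//; last lra.
      by lra.
    have [s2|s2] := leP s 2^-1.
      suff : s <= rnorm (w s) by lra.
      have -> : w s = (1 - s)%:C *: (u + v) - (1 - 2 * s)%:C *: v.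
        rewrite wE scalerDr -addrA -scalerBl -rmorphB/=.
        by congr (_ + _%:C *: _); lra.
      have := rnormB_le ((1 - s)%:C *: (u + v)) ((1 - 2 * s)%:C *: v).
      rewrite !rnormZr v1 !ger0_norm; [|lra|lra].
      have : (1 - s) * 1 <= (1 - s) * rnorm (u + v) by rewrite ler_wpM2l//; lra.
      by lra.
    suff : 1 - s <= rnorm (w s) by lra.
    have -> : w s = s%:C *: (u + v) - (2 * s - 1)%:C *: u.
      rewrite wE scalerDr addrAC -scalerBl -rmorphB/=.
      by congr (_%:C *: _ + _); lra.
    have := rnormB_le (s%:C *: (u + v)) ((2 * s - 1)%:C *: u).
    rewrite !rnormZr u1 !ger0_norm; [|lra|lra].
    have : s * 1 <= s * rnorm (u + v) by rewrite ler_wpM2l.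
    by lra.
  have wp s : 0 <= s <= 1 -> 0 < rnorm (w s) by move=> /w3; lra.
  (* Consecutive points of the segment are at most [2 / N] apart; normalizing points of norm at
     least 1/3 turns this into at most [12 / N < theta]. *)
  pose N := (Num.truncn (12 / theta)).+1.
  have N0 : 0 < N%:R :> R by rewrite ltr0n.
  have thN : 12 / N%:R < theta.
    rewrite ltr_pdivrMr// mulrC -ltr_pdivrMr//.
    by rewrite truncnS_gt.
  move: N N0 thN => N N0 thN.
  have kN k : (k <= N)%N -> 0 <= (k%:R / N%:R : R) <= 1.
    move=> kN; rewrite divr_ge0 ?ler0n//= ler_pdivrMr// mul1r.
    by rewrite ler_nat.
  have step k : (k <= N)%N ->
      exists2 U, isometry U & U u = normalize (w (k%:R / N%:R)).
    elim: k => [_|k IH kN1].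
      exists id; first exact: isometry_id.
      by rewrite mul0r /w scale0r addr0 normalize_id.
    have [U IU Uu] := IH (ltnW kN1).
    have [V [IV Vw _]] : exists V, [/\ isometry V,
        V (normalize (w (k%:R / N%:R))) = normalize (w (k.+1%:R / N%:R)) &
        forall z, rnorm (V z - z) <= 1 * rnorm z].
      apply: thP; rewrite ?rnorm_normalize ?wp ?kN// 1?ltnW//.
      apply: le_lt_trans thN.
      apply: (le_trans (normalize_dist _ _)); rewrite ?wp ?kN// 1?ltnW//.
      rewrite ler_pdivrMr ?wp ?kN// 1?ltnW//.
      have := wdist (k%:R / N%:R) (k.+1%:R / N%:R).
      have -> : k%:R / N%:R - k.+1%:R / N%:R = - N%:R^-1 :> R.
        by rewrite -natr1; field; rewrite lt0r_neq0.
      rewrite normrN ger0_norm ?invr_ge0 ?ler0n// => le1.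
      have := w3 _ (kN _ (ltnW kN1)).
      have Ni : 0 <= N%:R^-1 :> R by rewrite invr_ge0 ler0n.
      by move=> /(ler_wpM2l Ni); lra.
    by exists (V \o U); [exact: isometry_comp|rewrite /= Uu].
  have [U IU] := step N (leqnn N).
  by rewrite divff ?lt0r_neq0// /w scale1r subrKC normalize_id//; exists U.
move=> u v u1 v1; have [uv|uv] := leP 1 (rnorm (u + v)); first exact: far.
have [||U IU Uu] := far u (- v) u1; rewrite ?rnormN//.
  have := rnormD (u + v) (u - v).
  rewrite addrACA subrr addr0 -[u + u]mulr2n -scaler_nat.
  have -> : (2%:R : R[i]) = (2%:R : R)%:C by rewrite rmorph_nat.
  by rewrite rnormZr u1 ger0_norm//; lra.
exists (GRing.opp \o U); first exact: isometry_comp isometry_opp IU.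
by rewrite /= Uu opprK.
Qed.

End transitivity.

(** * Uniform convexity *)

Section slices.
Context {R : realType} {X : normedModType R[i]}.
Implicit Types (x y z u v : X) (g f : X -> R).

Definition slice g (a : R) : set X := [set x | rnorm x <= 1 /\ a < g x].

(** The functional need only lie in the dual ball, because [avoid_ball] forms convex combinations
    whose norm has no lower bound. *)
Definition is_slice (S : set X) :=
  exists g a, [/\ ball1 g, 0 <= a, S = slice g a & S !=set0].

Definition wide (eps : R) := forall S, is_slice S ->
  exists x y, [/\ S x, S y & eps < rnorm (x - y)].

Definition totally_bounded_set (K : set X) := forall e : R, 0 < e ->
  exists L : seq X, forall x, K x -> exists2 z, z \in L & rnorm (x - z) < e.

Definition convex_subset (K : set X) := forall (a b : R) x y, 0 <= a -> 0 <= b ->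
  a + b = 1 -> K x -> K y -> K (a%:C *: x + b%:C *: y).

Lemma ball1_opp g : ball1 g -> ball1 (fun x => - g x).
Proof.
move=> [lg gN]; split=> [|x].
  by apply: real_linearP => a x y; rewrite real_linearD// real_linearZ//; ring.
by rewrite -real_linearN// (le_trans (gN _))// rnormN.
Qed.

Lemma is_slice_convex S : is_slice S -> convex_subset S.
Proof.
move=> [g [a [[lg _] _ -> _]]] p q x y p0 q0 pq [x1 ax] [y1 ay]; split.
  rewrite (le_trans (rnormD _ _))// !rnormZr !ger0_norm//.
  have := ler_wpM2l p0 x1; have := ler_wpM2l q0 y1; lra.
rewrite real_linearD// !real_linearZ//.
have := ler_wpM2l p0 (ltW ax); have := ler_wpM2l q0 (ltW ay).
have [pz|p1] := eqVneq p 0.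
  by have q1 : q = 1 by [lra]; rewrite pz q1; lra.
have : p * a < p * g x by rewrite ltr_pM2l// lt_neqAle eq_sym p1.
have : a = p * a + q * a by rewrite -mulrDl pq mul1r.
by lra.
Qed.

Section avoid.
Variable eps : R.
Hypotheses (eps0 : 0 < eps) (weps : wide eps).

(** Tilt the functional [f] of the slice slightly towards some [k]. Near the top of the slice there
    are two points more than [eps] apart, so a norming functional of their difference, up to sign,
    exceeds its value at [z] by [eps / 2] at one of them. That point lies in a slice of [f + t k]
    which contains no point within [eps / 8] of [z]. *)
Lemma avoid_ball S z : is_slice S -> exists S', [/\ is_slice S', S' `<=` S &
  forall x, S' x -> eps / 8 <= rnorm (x - z)].
Proof.
move=> sS; have [f [a [f1 a0 SE [x0 Sx0]]]] := sS.
have bnd x : rnorm x <= 1 -> f x <= 1 by move=> x1; exact: le_trans (f1.2 x) x1.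
pose F := [set f x | x in [set x | rnorm x <= 1]].
have F0 : F !=set0 by exists (f 0), 0 => //=; rewrite rnorm0.
have supF : has_sup F by split => //; exists 1 => _ [x x1 <-]; exact: bnd.
set s := sup F; have fs x : rnorm x <= 1 -> f x <= s.
  by move=> x1; apply: ub_le_sup; [exact: supF.2|exists x].
have as_ : a < s.
  by move: Sx0; rewrite SE => -[x1 ax]; rewrite (lt_le_trans ax)// fs.
pose m := rnorm z + 1; have m1 : 1 <= m by rewrite lerDr rnorm_ge0.
(* This tilt changes [f] by at most [t * (|z| + 1) = (s - a) / 2], so the new slice stays inside the
   old one and its level stays nonnegative. *)
pose t := (s - a) / (2 * m).
have t0 : 0 < t by rewrite divr_gt0//; lra.
have tm : t * m = (s - a) / 2 by rewrite /t; field; lra.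
have te : 0 < t * eps by rewrite mulr_gt0.
have [y1 [y2 [[y11 fy1] [y21 fy2] y12]]] :
    exists x y, [/\ slice f (Num.max 0 (s - t * eps / 8)) x,
    slice f (Num.max 0 (s - t * eps / 8)) y & eps < rnorm (x - y)].
  apply: weps; exists f, (Num.max 0 (s - t * eps / 8)); split=> //.
    by rewrite le_max lexx.
  have : Num.max 0 (s - t * eps / 8) < s.
    by rewrite gt_max; apply/andP; split; lra.
  by move=> /(sup_gt F0) [_ [x x1 <-] xs]; exists x; split.
move: fy1 fy2; rewrite !gt_max => /andP[_ fy1] /andP[_ fy2].
have [h h1 hy] := norming_real (y1 - y2).
have [k [x' [k1 x'1 fx' kx']]] : exists k x', [/\ ball1 k, rnorm x' <= 1,
    s - t * eps / 8 < f x' & eps / 2 <= k x' - k z].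
  have [h2|h2] := leP (eps / 2) (h y1 - h z).
    by exists h, y1; split.
  exists (fun x => - h x), y2; split=> //; first exact: ball1_opp.
  by move: hy; rewrite (real_linearB h1.1); lra.
have kb x : rnorm x <= 1 -> - 1 <= k x <= 1.
  by move=> x1; rewrite -ler_norml (le_trans (ball1_norm _ k1)).
have kz : - rnorm z <= k z <= rnorm z by rewrite -ler_norml ball1_norm.
pose g x := (1 + t)^-1 * f x + (t / (1 + t)) * k x.
have t1 : 0 < 1 + t by lra.
have gE x : (1 + t) * g x = f x + t * k x by rewrite /g; field; lra.
pose b := (s + t * k z + t * eps / 8) / (1 + t).
have bE : (1 + t) * b = s + t * k z + t * eps / 8.
  by rewrite /b; field; lra.
have bg x : (b < g x) = (s + t * k z + t * eps / 8 < f x + t * k x).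
  by rewrite -(ltr_pM2l t1) bE gE.
have tkz : - t * rnorm z <= t * k z <= t * rnorm z.
  by rewrite mulNr -mulrN !ler_pM2l.
have tmE : t * rnorm z + t = (s - a) / 2 by rewrite -tm /m mulrDr mulr1.
exists (slice g b); split.
- exists g, b; split=> //.
  + split=> [|x]; first exact: (real_linear_comb _ _ f1.1 k1.1).
    rewrite -(ler_pM2l t1) gE mulrDl mul1r lerD ?f1.2//.
    by rewrite ler_pM2l ?k1.2.
  + by rewrite divr_ge0 ?(ltW t1)//; lra.
  + exists x'; split=> //; rewrite bg.
    by have := ler_wpM2l (ltW t0) kx'; lra.
- move=> x [x1]; rewrite bg SE => xb; split=> //.
  have /andP[_ kx] := kb _ x1; have := ler_wpM2l (ltW t0) kx; lra.
move=> x [x1]; rewrite bg leNgt => xb; apply/negP => xz.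
have := k1.2 (x - z); rewrite (real_linearB k1.1) => le1.
have := fs _ x1; have : k x - k z <= eps / 8 by lra.
by move=> /(ler_wpM2l (ltW t0)); lra.
Qed.

Lemma avoid_seq S (L : seq X) : is_slice S -> exists S', [/\ is_slice S',
  S' `<=` S & forall x z, S' x -> z \in L -> eps / 8 <= rnorm (x - z)].
Proof.
elim: L S => [|z L IH] S sS; first by exists S; split=> // x ?.
have [S1 [sS1 S1S S1z]] := avoid_ball z sS.
have [S2 [sS2 S2S1 S2L]] := IH _ sS1.
exists S2; split=> // [x /S2S1/S1S//|x y S2x].
rewrite inE => /predU1P[->|]; last exact: S2L.
exact: S1z (S2S1 _ S2x).
Qed.

(** Avoiding by [eps / 8] the centres of a finite [eps / 16]-net leaves distance [eps / 16] to the
    whole set. *)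
Lemma avoid_totally_bounded S K : is_slice S -> totally_bounded_set K ->
  exists S', [/\ is_slice S', S' `<=` S &
    forall x z, S' x -> K z -> eps / 16 <= rnorm (x - z)].
Proof.
move=> sS tK; have e16 : 0 < eps / 16 by rewrite divr_gt0.
have [L LP] := tK _ e16.
have [S' [sS' S'S S'L]] := avoid_seq L sS; exists S'; split=> // x z S'x.
move=> /LP[w wL zw]; have := S'L _ _ S'x wL.
by have := rnorm_triangle x z w; lra.
Qed.

End avoid.

(** For convex nonempty [K], the convex hull of [K] and [u], in explicit form. *)
Definition cone (K : set X) u : set X := [set x | exists a (s : R),
  [/\ K a, 0 <= s <= 1 & x = (1 - s)%:C *: a + s%:C *: u]].

Lemma sub_cone K u : K `<=` cone K u.
Proof.
move=> x Kx; exists x, 0; split=> //; first by rewrite lexx ler01.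
by rewrite subr0 scale1r scale0r addr0.
Qed.

Lemma cone_apex K u : K !=set0 -> cone K u u.
Proof.
move=> [x Kx]; exists x, 1; split=> //; first by rewrite lexx ler01.
by rewrite subrr scale1r scale0r add0r.
Qed.

Lemma cone_convex K u : convex_subset K -> convex_subset (cone K u).
Proof.
move=> cK p q _ _ p0 q0 pq [x [s [Kx /andP[s0 s1] ->]]] [y [t [Ky /andP[t0 t1] ->]]].
have ps : 0 <= p * (1 - s) by rewrite mulr_ge0// subr_ge0.
have qt : 0 <= q * (1 - t) by rewrite mulr_ge0// subr_ge0.
have ps' : 0 <= p * s by rewrite mulr_ge0.
have qt' : 0 <= q * t by rewrite mulr_ge0.
pose r := p * (1 - s) + q * (1 - t).
have rE : 1 - (p * s + q * t) = r by rewrite -pq /r; ring.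
have r0 : 0 <= r by rewrite addr_ge0.
have -> : p%:C *: ((1 - s)%:C *: x + s%:C *: u)
    + q%:C *: ((1 - t)%:C *: y + t%:C *: u)
  = ((p * (1 - s))%:C *: x + (q * (1 - t))%:C *: y) + (p * s + q * t)%:C *: u.
  rewrite !scalerDr !scalerA -!rmorphM addrACA; congr (_ + _).
  by rewrite -scalerDl -rmorphD.
have st : 0 <= p * s + q * t <= 1.
  by rewrite addr_ge0//=; move: r0; rewrite -rE; lra.
have [rz|rn] := eqVneq r 0.
  have [-> ->] : p * (1 - s) = 0 /\ q * (1 - t) = 0.
    by move: rz; rewrite /r => rz; split; lra.
  exists x, (p * s + q * t); split=> //.
  by rewrite rE rz !scale0r addr0.
exists ((p * (1 - s) / r)%:C *: x + (q * (1 - t) / r)%:C *: y), (p * s + q * t).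
split=> //; first by apply: cK; rewrite ?divr_ge0// -mulrDl divff.
congr (_ + _); rewrite rE scalerDr !scalerA -!rmorphM/=.
by congr (_%:C *: _ + _%:C *: _); field.
Qed.

Lemma cone_ball K u : (forall x, K x -> rnorm x <= 1) -> rnorm u <= 1 ->
  forall x, cone K u x -> rnorm x <= 1.
Proof.
move=> K1 u1 _ [x [s [Kx /andP[s0 s1] ->]]].
rewrite (le_trans (rnormD _ _))// !rnormZr !ger0_norm ?subr_ge0//.
have s1' : 0 <= 1 - s by rewrite subr_ge0.
have := ler_wpM2l s1' (K1 _ Kx); have := ler_wpM2l s0 u1; lra.
Qed.

Lemma cone_totally_bounded K u : (forall x, K x -> rnorm x <= 1) ->
  rnorm u <= 1 -> totally_bounded_set K -> totally_bounded_set (cone K u).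
Proof.
move=> K1 u1 tK e e0; have [L LP] := tK (e / 2) ltac:(lra).
(* A step of [1 / N] in the parameter moves a point by at most [2 / N < e / 2]; the net of [K] uses
   the other half of [e]. *)
pose N := (Num.truncn (4 / e)).+1.
have N0 : 0 < N%:R :> R by rewrite ltr0n.
have NE : 4 / N%:R < e.
  by rewrite ltr_pdivrMr// mulrC -ltr_pdivrMr// truncnS_gt.
move: N N0 NE => N N0 NE.
pose pt z j := (1 - j%:R / N%:R : R)%:C *: z + (j%:R / N%:R : R)%:C *: u.
exists [seq pt z j | z <- L, j <- iota 0 N.+1].
move=> _ [x [s [Kx /andP[s0 s1] ->]]].
have [z zL xz] := LP _ Kx.
pose j := Num.truncn (s * N%:R).
have sN : 0 <= s * N%:R by rewrite mulr_ge0// ltW.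
have /andP[j1 j2] : j%:R <= s * N%:R < j.+1%:R by rewrite truncn_itv.
have jN : (j <= N)%N.
  by rewrite -(ler_nat R) (le_trans j1)// ler_piMl// ltW.
have a1 : j%:R / N%:R <= s by rewrite ler_pdivrMr.
have a2 : s < j%:R / N%:R + N%:R^-1.
  by rewrite -[X in _ + X]mul1r -mulrDl natr1 ltr_pdivlMr.
exists (pt z j); first by apply: allpairs_f => //; rewrite mem_iota add0n ltnS.
set s' := j%:R / N%:R in a1 a2 *.
have s'0 : 0 <= s' by rewrite divr_ge0.
have -> : (1 - s)%:C *: x + s%:C *: u - pt z j
    = (1 - s')%:C *: (x - z) + (s' - s)%:C *: (x - u).
  apply/eqP; rewrite subr_eq /pt -/s' addrACA -scalerDr subrK.
  rewrite scalerBr -addrA [- _ + _]addrC -scalerBl addrA -scalerDl.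
  by rewrite -rmorphB -rmorphD/=; apply/eqP; congr (_%:C *: _ + _%:C *: _); ring.
apply: le_lt_trans (rnormD _ _) _; rewrite !rnormZr.
have xu : rnorm (x - u) <= 2.
  by rewrite (le_trans (rnormD _ _))// rnormN; have := K1 _ Kx; lra.
rewrite ger0_norm ?subr_ge0//; last lra.
rewrite ler0_norm; last lra.
have : (1 - s') * rnorm (x - z) <= 1 * rnorm (x - z).
  by rewrite ler_wpM2r ?rnorm_ge0//; lra.
have : (s - s') * rnorm (x - u) <= N%:R^-1 * 2.
  by rewrite ler_pM ?rnorm_ge0//; lra.
by lra.
Qed.

End slices.
Arguments wide {R} X eps.

Lemma dependent_choice_nat (T : Type) (P : nat -> T -> Prop)
    (Q : nat -> T -> T -> Prop) (s0 : T) : P 0%N s0 ->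
  (forall n s, P n s -> exists s', P n.+1 s' /\ Q n s s') ->
  exists f : nat -> T, f 0%N = s0 /\ forall n, P n (f n) /\ Q n (f n) (f n.+1).
Proof.
move=> P0 H.
pose step n (s : {s | P n s}) := cid (H n (sval s) (svalP s)).
pose F := fix F n : {s | P n s} := if n is m.+1 return {s | P n s} then
  exist _ (sval (step m (F m))) (svalP (step m (F m))).1 else exist _ s0 P0.
exists (fun n => sval (F n)); split=> // n; split; first exact: svalP.
exact: (svalP (step n (F n))).2.
Qed.

(** * James' argument: separated sequences and their exclusion *)

Section james.
Context {R : realType} {X : normedModType R[i]}.
Implicit Types (x y z u v : X) (g f : X -> R).

Lemma totally_bounded_set1 u : totally_bounded_set [set u].
Proof.
by move=> e e0; exists [:: u] => x ->; exists u; rewrite ?inE// subrr rnorm0.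
Qed.

(** The state is a hull [K] of the points chosen so far, a slice [T] for the later ones, and the
    last point. Each step shrinks [T] away from [K], which is totally bounded, picks a point of the
    new [T] and adds it to the hull. Differences between the new slice and the old hull form a
    convex set far from 0, and [separation] gives [g k]. *)
Lemma wide_separated_sequence (eps : R) : 0 < eps -> wide X eps ->
  forall S : set X, is_slice S -> exists (u : nat -> X) (g : nat -> X -> R),
    (forall n, rnorm (u n) <= 1) /\
    forall k, ball1 (g k) /\ forall i n, (i <= k < n)%N ->
      eps / 16 <= g k (u n - u i).
Proof.
move=> e0 we S sS; have S1 T x : is_slice T -> T x -> rnorm x <= 1.
  by move=> [g [a [_ _ -> _]]] [].
have [u0 Su0] : S !=set0 by have [g [a []]] := sS.
pose P (_ : nat) (s : set X * set X * X) :=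
  [/\ is_slice s.1.2, convex_subset s.1.1, totally_bounded_set s.1.1,
      forall x, s.1.1 x -> rnorm x <= 1 & s.1.1 s.2].
pose Q (_ : nat) (s s' : set X * set X * X) :=
  [/\ s.1.1 `<=` s'.1.1, s'.1.2 `<=` s.1.2, s'.1.2 s'.2 &
      forall x z, s'.1.2 x -> s.1.1 z -> eps / 16 <= rnorm (x - z)].
have [||f [_ fP]] := @dependent_choice_nat _ P Q ([set u0], S, u0).
- split=> //=; last by move=> x ->; exact: S1 Su0.
  + move=> a b _ _ _ _ ab -> ->.
    by rewrite /= -scalerDl -rmorphD/= ab scale1r.
  + exact: totally_bounded_set1.
- move=> n [[K T] u] [/= sT cK tK K1 Ku].
  have [T' [sT' T'T T'K]] := avoid_totally_bounded e0 we sT tK.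
  have [u' T'u'] : T' !=set0 by have [g [a []]] := sT'.
  have u'1 := S1 _ _ sT' T'u'.
  exists (cone K u', T', u'); split; split=> //=.
  + exact: cone_convex.
  + exact: cone_totally_bounded.
  + exact: cone_ball.
  + by apply: cone_apex; exists u.
  + exact: sub_cone.
have Kmono : {homo (fun n => (f n).1.1) : m n / (m <= n)%N >-> m `<=` n}.
  apply: homo_leq => [A //|B A C AB BC|n]; first exact: subset_trans BC.
  by have [_ []] := fP n.
have Tmono : {homo (fun n => (f n).1.2) : m n / (m <= n)%N >-> n `<=` m}.
  apply: (@homo_leq _ _ (fun A B => B `<=` A)) => [A //|B A C AB BC|n].
    exact: subset_trans AB.
  by have [_ []] := fP n.
have Tu n : (f n.+1).1.2 (f n.+1).2 by have [_ []] := fP n.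
have sep k : exists g, ball1 g /\ forall i n, (i <= k < n)%N ->
    eps / 16 <= g ((f n).2 - (f i).2).
  pose D := [set d | exists x z, [/\ (f k.+1).1.2 x, (f k).1.1 z & d = x - z]].
  have [[_ cK _ _ Ku] [_ _ _ av]] := fP k; have [[sT _ _ _ _] _] := fP k.+1.
  have [||d [x [z [Tx Kz ->]]]|g g1 gD] :=
    @separation _ _ D (eps / 16) ((f k.+1).2 - (f k).2); last 1 first.
  - exists g; split=> // i n /andP[ik]; case: n => // n kn; apply: gD.
    exists (f n.+1).2, (f i).2; split=> //; first exact: Tmono (Tu n).
    by apply: Kmono ik _ _; have [[]] := fP i.
  - by exists (f k.+1).2, (f k).2.
  - move=> a b _ _ a0 b0 ab [x [z [Tx Kz ->]]] [x' [z' [Tx' Kz' ->]]].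
    exists (a%:C *: x + b%:C *: x'), (a%:C *: z + b%:C *: z'); split.
    + exact: is_slice_convex.
    + exact: cK.
    + by rewrite !scalerBr opprD addrACA.
  - exact: av.
have [g gP] := choice (fun k => sep k).
exists (fun n => (f n).2), g; split=> // n.
by have [[_ _ _ K1 Ku] _] := fP n; exact: K1.
Qed.

(* James-type argument: uniform convexity of the dual forces almost minimal  *)
(* separating functionals to be close to each other, so a single one         *)
(* separates all the terms by a fixed amount and is unbounded.               *)
Lemma smooth_no_separated_sequence (c : R) (u : nat -> X) (g : nat -> X -> R) :
  uniformly_smooth X -> 0 < c -> (forall n, rnorm (u n) <= 1) ->
  (forall k, ball1 (g k) /\ forall i n, (i <= k < n)%N -> c <= g k (u n - u i)) ->
  False.
Proof.
move=> sX c0 u1 gP.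
(* Requiring the gap only eventually in [n] makes the condition stable under averaging two
   functionals. The infimum [s] of the bounds [d] that work for all [k] is at least [c / 2], because
   the points lie in the unit ball. *)
pose G k d f := [/\ real_linear f, forall x, f x <= d * rnorm x &
  forall i, (i <= k)%N -> exists m, forall n, (m <= n)%N -> c <= f (u n - u i)].
have Gle k d f : G k d f -> c / 2 <= d.
  move=> [lf fd /(_ _ (leq0n k))[m /(_ _ (leqnn m)) le1]].
  have le2 := fd (u m - u 0%N).
  have d0 : 0 <= d.
    have : 0 < d * rnorm (u m - u 0%N) by lra.
    have := rnorm_ge0 (u m - u 0%N); rewrite le_eqVlt => /predU1P[<-|p].
      by rewrite mulr0 ltxx.
    by rewrite pmulr_lgt0// => /ltW.
  have le3 : rnorm (u m - u 0%N) <= 2.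
    by rewrite (le_trans (rnormD _ _))// rnormN; have := u1 m; have := u1 0%N; lra.
  by have := ler_wpM2l d0 le3; lra.
pose A := [set d | forall k, exists f, G k d f].
have A1 : A 1.
  move=> k; exists (g k); have [[lg gN] gc] := gP k; split=> //.
    by move=> x; rewrite mul1r.
  by move=> i ik; exists k.+1 => n kn; apply: gc; rewrite ik.
have infA : has_inf A.
  by split; [exists 1|exists (c / 2) => d /(_ 0%N)[f /Gle]].
set s := inf A; have sc : c / 2 <= s.
  by apply: lb_le_inf; [exact: infA.1|move=> d /(_ 0%N)[f /Gle]].
have s0 : 0 < s by lra.
have [delta de0 deP] := uniformly_smooth_dual sX
  (divr_gt0 c0 (mulr_gt0 (ltr0n R 8) s0)).
(* [4 * eta <= delta * s] makes a value above [s - 3 eta] exceed [1 - delta] after division by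
   [s + eta]; [eta <= s] bounds that divisor by [2 s]. *)
pose eta := Num.min (delta * s / 4) s.
have ds : 0 < delta * s by rewrite mulr_gt0.
have eta0 : 0 < eta by rewrite lt_min; apply/andP; split; lra.
have [eta1 eta2] : eta <= delta * s / 4 /\ eta <= s.
  by split; rewrite /eta ge_min lexx ?orbT.
have Aeta k : exists f, G k (s + eta) f.
  have [d Ad ds'] := inf_adherent eta0 infA.
  have [f [lf fd fu]] := Ad k; exists f; split=> // x.
  by rewrite (le_trans (fd x))// ler_wpM2r ?rnorm_ge0// ltW.
have [k notG] : exists k, forall f, ~ G k (s - eta) f.
  apply/not_existsP => nG; have : A (s - eta).
    by move=> k; apply: contrapT => /forallNP; exact: nG.
  by move=> /(ge_inf infA.2); rewrite -/s; lra.
have [f [lf fd fu]] := Aeta k.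
(* The average of [f] and a functional [h] good up to [maxn k i] is still good up to [k], so it
   exceeds [s - eta] at some unit vector. There both [f] and [h] exceed [s - 3 eta], hence they are
   close, and [f] inherits from [h] half of the gap over [u i]. *)
have fgap i : exists m, forall n, (m <= n)%N -> c / 2 <= f (u n - u i).
  have [h [lh hd hu]] := Aeta (maxn k i).
  have [m hm] := hu i (leq_maxr _ _).
  pose a x := 2^-1 * f x + 2^-1 * h x.
  have [x ax] : exists x, (s - eta) * rnorm x < a x.
    apply: contrapT => /forallNP na; apply: (notG a); split.
    - exact: real_linear_comb.
    - by move=> x; rewrite leNgt; apply/negP => /na.
    - move=> j jk; have [p fp] := fu _ jk.
      have [q hq] := hu j (leq_trans jk (leq_maxl _ _)).
      exists (maxn p q) => n; rewrite geq_max => /andP[/fp le1 /hq le2].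
      by rewrite /a; lra.
  have x0 : 0 < rnorm x.
    apply: rnorm_gt0; apply/eqP => x0; move: ax.
    by rewrite /a x0 rnorm0 !real_linear0//; lra.
  have y1 := rnorm_normalize x0.
  have ay : s - eta < a (normalize x).
    rewrite -(ltr_pM2l x0) mulrC (lt_le_trans ax)// -(normalizeE x0).
    by rewrite /a [f (_ *: _)]real_linearZ// [h (_ *: _)]real_linearZ//
      normalizeE//; lra.
  have fy := fd (normalize x); have hy := hd (normalize x).
  rewrite y1 mulr1 in fy; rewrite y1 mulr1 in hy.
  rewrite /a in ay.
  have se : 0 < s + eta by lra.
  (* The zero summand gives the quotient of [p] by [s + eta] the shape that [real_linear_comb]
     proves linear. *)
  pose sc_ (p : X -> R) z := (s + eta)^-1 * p z + 0 * p z.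
  have scE p z : (s + eta) * sc_ p z = p z.
    by rewrite /sc_; field; rewrite lt0r_neq0.
  have sc1 p : real_linear p -> (forall z, p z <= (s + eta) * rnorm z) ->
      ball1 (sc_ p).
    move=> lp pd; split=> [|z]; first exact: real_linear_comb.
    by rewrite -(ler_pM2l se) scE.
  have big p : s - 3 * eta < p (normalize x) -> 1 - delta < sc_ p (normalize x).
    move=> py; rewrite -(ltr_pM2l se) scE (le_lt_trans _ py)//.
    have := mulr_gt0 de0 eta0; lra.
  have close := deP _ _ _ _ (sc1 f lf fd) (sc1 h lh hd) (big f _) (big h _).
  exists m => n mn; have := hm _ mn.
  set d := u n - u i.
  have d2 : rnorm d <= 2.
    by rewrite (le_trans (rnormD _ _))// rnormN; have := u1 n; have := u1 i; lra.
  have : `|sc_ f d - sc_ h d| <= c / (8 * s) * rnorm d.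
    by apply: close; rewrite ?y1//; lra.
  rewrite ler_norml => /andP[le1 _].
  have le2 : c / (8 * s) * rnorm d <= c / (8 * s) * 2.
    by rewrite ler_wpM2l// divr_ge0// ltW// mulr_gt0.
  have : (s + eta) * (- (c / (8 * s) * 2)) <= (s + eta) * (sc_ f d - sc_ h d).
    by rewrite ler_pM2l//; lra.
  rewrite mulrBr !scE => le3 le4.
  have : (s + eta) * (c / (8 * s) * 2) <= (2 * s) * (c / (8 * s) * 2).
    rewrite ler_wpM2r//; last lra.
    by rewrite mulr_ge0// divr_ge0// ltW// mulr_gt0.
  have -> : (2 * s) * (c / (8 * s) * 2) = c / 2 by field; rewrite lt0r_neq0.
  by lra.
(* Chaining the gaps [c / 2] makes [f] unbounded along the sequence, which is bounded. *)
have grow N : exists n, f (u 0%N) + N%:R * (c / 2) <= f (u n).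
  elim: N => [|N [n IH]]; first by exists 0%N; rewrite mul0r addr0.
  have [m /(_ _ (leqnn m))] := fgap n.
  by rewrite real_linearB// => le1; exists m; rewrite -natr1; lra.
have [n] := grow (Num.truncn ((s + eta) * 2 / (c / 2))).+1.
set N := Num.truncn _.
have : (s + eta) * 2 / (c / 2) < N.+1%:R by exact: truncnS_gt.
rewrite ltr_pdivrMr; last lra.
have := fd (u n - u 0%N); rewrite real_linearB//.
have : (s + eta) * rnorm (u n - u 0%N) <= (s + eta) * 2.
  rewrite ler_wpM2l//; first lra.
  by rewrite (le_trans (rnormD _ _))// rnormN; have := u1 n; have := u1 0%N; lra.
by lra.
Qed.

End james.

Section uniform_convexity.
Context {R : realType} (X : normedModType R[i]).

Definition uniformly_exposed := forall eps : R, 0 < eps ->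
  exists2 delta : R, 0 < delta & forall (u : X) g z, rnorm u = 1 -> ball1 g ->
    g u = 1 -> rnorm z <= 1 -> 1 - delta < g z -> rnorm (z - u) <= eps.

(** Near the top of the slice choose a unit vector [v] almost normed by [f / s]; a norming
    functional [g] of [v] is then close to [f / s]. An isometry carries a bad pair [u0], [z0] to
    [v], [V z0], and [g \o V] is close to [g0] since both norm [u0]. Hence [V z0] lies in the slice,
    more than [eps] away from [v]. *)
Lemma exposed_or_wide (eps : R) : micro_transitive X -> 0 < eps ->
  (forall delta : R, 0 < delta -> exists (u : X) g z, [/\ rnorm u = 1, ball1 g,
    g u = 1, rnorm z <= 1 & 1 - delta < g z /\ eps < rnorm (z - u)]) ->
  wide X eps.
Proof.
move=> mX e0 bad S [f [a [f1 a0 -> [x0 [x01 ax0]]]]].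
pose F := [set f x | x in [set x | rnorm x <= 1]].
have supF : has_sup F.
  split; first by exists (f x0), x0.
  by exists 1 => _ [x x1 <-]; exact: le_trans (f1.2 x) x1.
set s := sup F; have fs x : rnorm x <= 1 -> f x <= s.
  by move=> x1; apply: ub_le_sup; [exact: supF.2|exists x].
have sa : a < s by rewrite (lt_le_trans ax0)// fs.
have s0 : 0 < s by rewrite (le_lt_trans a0).
(* Three errors of size [e] lower [f] by [3 (s - a) / 4], which keeps it above [a]. *)
pose e := (s - a) / (4 * s).
have se : s * e = (s - a) / 4 by rewrite /e; field; rewrite lt0r_neq0.
have ep : 0 < e by rewrite divr_gt0//; lra.
have [delta d0 dP] := uniformly_smooth_dual (micro_transitive_smooth mX) ep.
have [v' [v'1 fv']] : exists v', rnorm v' <= 1 /\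
    Num.max a (s * (1 - delta)) < f v'.
  have : Num.max a (s * (1 - delta)) < s.
    by rewrite gt_max sa mulrBr mulr1 gtrBl mulr_gt0.
  by move=> /(sup_gt supF.1)[_ [x x1 <-] xs]; exists x.
move: fv'; rewrite gt_max => /andP[av' dv'].
have v'0 : 0 < rnorm v' by have := f1.2 v'; lra.
have v1 := rnorm_normalize v'0; set v := normalize v' in v1.
have fv : f v' <= f v.
  rewrite -{1}(normalizeE v'0) (real_linearZ f1.1) -/v ger_pMl//.
  have := fs v; rewrite -(pmulr_rgt0 _ v'0) -(real_linearZ f1.1).
  by rewrite normalizeE//; lra.
pose fn x := s^-1 * f x + 0 * f x.
have fnE x : s * fn x = f x by rewrite /fn; field; rewrite lt0r_neq0.
have fn1 : ball1 fn.
  split=> [|x]; first exact: (real_linear_comb _ _ f1.1 f1.1).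
  rewrite -(ler_pM2l s0) fnE; have [->|xn0] := eqVneq x 0.
    by rewrite (real_linear0 f1.1) rnorm0 mulr0.
  have x1 := rnorm_gt0 xn0.
  rewrite -{1}(normalizeE x1) (real_linearZ f1.1) mulrC ler_pM2r//.
  by rewrite fs// rnorm_normalize.
have [g g1 gv] := norming_real v; rewrite v1 in gv.
have fnv : 1 - delta < fn v.
  by rewrite -(ltr_pM2l s0) fnE (lt_le_trans dv').
have gd : 1 - delta < g v by rewrite gv ltrBlDr ltrDl.
have cl1 := dP _ _ _ (_ : rnorm v <= 1) fn1 g1 fnv gd.
have [u0 [g0 [z0 [u01 g01 gu0 z01 [gz0 zu0]]]]] := bad e ep.
have [V IV Vu] := micro_transitive_transitive mX u01 v1.
have cl2 : `|g0 z0 - g (V z0)| <= e * rnorm z0.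
  apply: (dP u0 g0 (g \o V)) => //=; rewrite ?u01 ?gu0 ?Vu ?gv//.
  - exact: ball1_isometry.
  - by rewrite ltrBlDr ltrDl.
  - by rewrite ltrBlDr ltrDl.
have {}cl1 : `|fn (V z0) - g (V z0)| <= e * rnorm (V z0).
  by apply: cl1; rewrite v1.
have ez : e * rnorm z0 <= e by rewrite ler_piMr// ltW.
exists (V z0), v; split.
- split; first by rewrite IV.2.
  move: cl1 cl2; rewrite IV.2 !ler_norml => /andP[le1 _] /andP[_ le2].
  have : 1 - 3 * e < fn (V z0) by lra.
  by rewrite -(ltr_pM2l s0) fnE; lra.
- by split; [rewrite v1|rewrite (lt_le_trans av')].
- by rewrite -Vu -isometryB// IV.2.
Qed.

Theorem micro_transitive_exposed : micro_transitive X -> uniformly_exposed.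
Proof.
move=> mX eps e0; apply: contrapT => nex.
have bad (delta : R) : 0 < delta -> exists (u : X) g z, [/\ rnorm u = 1, ball1 g,
    g u = 1, rnorm z <= 1 & 1 - delta < g z /\ eps < rnorm (z - u)].
  move=> d0; apply: contrapT => nb; apply: nex; exists delta => // u g z u1 g1 gu z1 gz.
  by rewrite leNgt; apply/negP => zu; apply: nb; exists u, g, z.
have weps := exposed_or_wide mX e0 bad.
have [u [g [z [u1 g1 gu z1 _]]]] := bad 1 ltr01.
have sS : is_slice (slice g 0).
  by exists g, 0; split=> //; exists u; split; rewrite ?u1 ?gu.
have [w [h [w1 hP]]] := wide_separated_sequence e0 weps sS.
apply: (smooth_no_separated_sequence (micro_transitive_smooth mX) _ w1 hP).
by rewrite divr_gt0.
Qed.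

End uniform_convexity.

(** * Forms on finite sums *)

Section limits.
Context {R : realType}.

Definition half (n : nat) : R := 2^-1 ^+ n.

Lemma half_gt0 n : 0 < half n. Proof. by rewrite exprn_gt0// invr_gt0. Qed.

Lemma halfS n : half n.+1 = half n / 2.
Proof. by rewrite /half exprSr. Qed.

Lemma half_small (K e : R) : 0 < e -> exists n, K * half n < e.
Proof.
move=> e0; have [K0|K0] := leP K 0.
  by exists 0%N; rewrite (le_lt_trans _ e0)// mulr_le0_ge0// ltW// half_gt0.
exists (Num.truncn (K / e)).+1; set n := _.+1.
have Kn : K / e < n%:R by exact: truncnS_gt.
have : n%:R < (2 ^ n)%:R :> R by rewrite ltr_nat ltn_expl.
rewrite natrX => n2; rewrite /half exprVn ltr_pdivrMr ?exprn_gt0//.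
by rewrite mulrC -ltr_pdivrMr// (lt_trans Kn).
Qed.

Lemma le_half (K a b : R) : (forall n, a <= b + K * half n) -> a <= b.
Proof.
move=> h; rewrite leNgt; apply/negP => ba.
have ab : 0 < a - b by rewrite subr_gt0.
by have [n] := half_small K ab; have := h n; lra.
Qed.

Lemma half_cauchy (V : normedZmodType R[i]) (u : nat -> V) (C : R) :
  (forall n, rnorm (u n.+1 - u n) <= C * half n) ->
  forall n k, (n <= k)%N -> rnorm (u k - u n) <= 2 * C * half n.
Proof.
move=> uC n k /subnK <-; have C0 : 0 <= C.
  by have := le_trans (rnorm_ge0 _) (uC 0%N); rewrite /half mulr1.
suff : rnorm (u (k - n + n)%N - u n) <= 2 * C * (half n - half (k - n + n)).
  by have := mulr_ge0 C0 (ltW (half_gt0 (k - n + n))); lra.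
elim: (k - n)%N => [|j IH]; first by rewrite !subrr rnorm0 mulr0.
have := rnorm_triangle (u (j.+1 + n)%N) (u (j + n)%N) (u n).
by have := uC (j + n)%N; rewrite addSn halfS; lra.
Qed.

(** One limit operator serves all constants [C], so the pointwise limit of forms is a single
    function although the rate depends on the arguments. *)
Definition fast_lim_spec (V : normedZmodType R[i]) (l : (nat -> V) -> V) :=
  forall u (C : R), (forall n, rnorm (u n.+1 - u n) <= C * half n) ->
  forall n, rnorm (u n - l u) <= 2 * C * half n.

Lemma fast_lim_exists (V : normedZmodType R[i]) :
  (forall (u : nat -> V) (C : R), (forall n, rnorm (u n.+1 - u n) <= C * half n) ->
    exists (l : V) (D : R), forall n, rnorm (u n - l) <= D * half n) ->
  exists l : (nat -> V) -> V, fast_lim_spec l.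
Proof.
move=> H; have : forall u : nat -> V, exists l : V, forall C : R,
    (forall n, rnorm (u n.+1 - u n) <= C * half n) ->
    forall n, rnorm (u n - l) <= 2 * C * half n.
  move=> u; have [[C uC]|nC] := pselect (exists C : R,
      forall n, rnorm (u n.+1 - u n) <= C * half n); last first.
    by exists 0 => C uC; exfalso; apply: nC; exists C.
  have [l [D uD]] := H u C uC; exists l => {}C {}uC n.
  apply: (@le_half D) => k.
  have le1 := half_cauchy uC (leq_maxl n k).
  have le2 := uD (maxn n k); have le3 := half_cauchy uC (leqnn n).
  have D0 : 0 <= D.
    by have := le_trans (rnorm_ge0 _) (uD 0%N); rewrite /half mulr1.
  have : half (maxn n k) <= half k.
    by rewrite /half ler_wiXn2l// ?leq_maxr// ?invr_ge0// invf_le1// ler1n.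
  move=> /(ler_wpM2l D0) le4.
  have := rnorm_triangle (u n) (u (maxn n k)) l.
  by rewrite (rnormBC (u n) (u _)); lra.
by move=> /choice[l lP]; exists l => u C; exact: lP.
Qed.

Lemma real_fast_lim (u : nat -> R) (C : R) :
  (forall n, `|u n.+1 - u n| <= C * half n) ->
  exists l, forall n, `|u n - l| <= 2 * C * half n.
Proof.
move=> uC; have uk n k : (n <= k)%N -> `|u k - u n| <= 2 * C * half n.
  move=> nk; have := @half_cauchy R[i] (fun n => (u n)%:C) C _ n k nk.
  rewrite -rmorphB rnorm_real; apply => j.
  by rewrite -rmorphB rnorm_real.
have C0 n : 0 <= 2 * C * half n by exact: le_trans (normr_ge0 _) (uk n n _).
pose A := range (fun n => u n - 2 * C * half n).
have ab n k : u n - 2 * C * half n <= u k + 2 * C * half k.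
  have := C0 n; have := C0 k.
  have [/uk|/ltnW/uk] := leqP n k; rewrite ler_norml => /andP[]; lra.
have A0 : A !=set0 by exists (u 0%N - 2 * C * half 0), 0%N.
exists (sup A) => n; rewrite ler_norml; apply/andP; split.
  have : sup A <= u n + 2 * C * half n.
    by apply: ge_sup => // _ [j _ <-]; exact: ab.
  by lra.
have : u n - 2 * C * half n <= sup A.
  apply: ub_le_sup; last by exists n.
  by exists (u 0%N + 2 * C * half 0) => _ [j _ <-]; exact: ab.
by lra.
Qed.

Lemma complex_fast_lim : exists l : (nat -> R[i]) -> R[i], fast_lim_spec l.
Proof.
apply: fast_lim_exists => u C uC.
have [a aP] : exists l, forall n, `|complex.Re (u n) - l| <= 2 * C * half n.
  by apply: real_fast_lim => n; rewrite -ReB (le_trans (normRe_le_rnorm _)).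
have [b bP] : exists l, forall n, `|complex.Im (u n) - l| <= 2 * C * half n.
  apply: real_fast_lim => n; have := uC n.
  case: (u n.+1) (u n) => [p q] [p' q'] /= h.
  (* Multiplication by [- 'i] turns the imaginary part into a real part. *)
  have := normRe_le_rnorm (- 'i * ((p +i* q) - (p' +i* q'))).
  rewrite rnormM rnormN rnormi mul1r => /(fun h' => le_trans h' h).
  by simpc.
exists (a +i* b), (4 * C) => n.
have -> : u n - (a +i* b) =
    (complex.Re (u n) - a)%:C + 'i * (complex.Im (u n) - b)%:C.
  by case: (u n) => p q; rewrite /real_complex_def; simpc.
rewrite (le_trans (rnormD _ _))// rnormM rnormi mul1r !rnorm_real.
by have := aP n; have := bP n; lra.
Qed.

Lemma banach_fast_lim (X : completeNormedModType R[i]) :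
  exists l : (nat -> X) -> X, fast_lim_spec l.
Proof.
apply: fast_lim_exists => u C uC; have uk := half_cauchy uC.
have cu : cvgn u.
  apply/cauchy_cvgP/cauchy_exP => e e0.
  have [d eE] : exists d : R, e = d%:C.
    by have /complex_realP := gtr0_real e0.
  have d0 : 0 < d by rewrite -ltcR -eE.
  have [n nd] := half_small (2 * C) d0.
  exists (u n); exists n => // k /= nk.
  rewrite -ball_normE /ball_/= -rnormE eE ltcR rnormBC.
  exact: le_lt_trans (uk _ _ nk) nd.
exists (limn u), (2 * C) => n; apply: (@le_half 1) => k.
have /cvgrPdist_lt/(_ (half k)%:C) := cu.
rewrite ltcR half_gt0 => /(_ isT)[N _ hN].
have le1 : rnorm (limn u - u (maxn N n)) < half k.
  by rewrite -ltcR rnormE; exact: hN (leq_maxl _ _).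
have := rnorm_triangle (u n) (u (maxn N n)) (limn u).
rewrite (rnormBC (u n) (u _)) (rnormBC (u (maxn N n)) (limn u)).
have := uk _ _ (leq_maxr N n); lra.
Qed.

End limits.

Definition bilinear_form (K : nzRingType) (V W : lmodType K) (T : V -> W -> K) :=
  (forall w, scalar (fun v => T v w)) /\ (forall v, scalar (T v)).

Section bilinear_form.
Context {K : nzRingType} {V W : lmodType K} (T : V -> W -> K).
Hypothesis bT : bilinear_form T.

Lemma bilinDl v v' w : T (v + v') w = T v w + T v' w.
Proof. exact: (scalarD (bT.1 w)). Qed.

Lemma bilinDr v w w' : T v (w + w') = T v w + T v w'.
Proof. exact: (scalarD (bT.2 v)). Qed.

Lemma bilinBl v v' w : T (v - v') w = T v w - T v' w.
Proof. exact: (scalarB (bT.1 w)). Qed.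

Lemma bilinBr v w w' : T v (w - w') = T v w - T v w'.
Proof. exact: (scalarB (bT.2 v)). Qed.

Lemma bilinZl a v w : T (a *: v) w = a * T v w.
Proof. exact: (scalarZ (bT.1 w)). Qed.

Lemma bilinZr a v w : T v (a *: w) = a * T v w.
Proof. exact: (scalarZ (bT.2 v)). Qed.

End bilinear_form.

(** * Finite sums of copies of X with the supremum norm *)

Section coordinates.
Context {R : realType} {X : normedModType R[i]} {m : nat}.
Implicit Types (x y z : 'I_m -> X).

Definition cball (a : R) x := forall i, rnorm (x i) <= a.
Definition csphere x := forall i, rnorm (x i) = 1.

Lemma csphere_cball x : csphere x -> cball 1 x.
Proof. by move=> x1 i; rewrite x1. Qed.

Lemma cballZ (a b : R) x : 0 <= b -> cball a x -> cball (b * a) (b%:C *: x).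
Proof.
by move=> b0 xa i; rewrite /= rnormZr ger0_norm// ler_wpM2l.
Qed.

Lemma cball_ex x : exists2 a : R, 0 < a & cball a x.
Proof.
exists (1 + \sum_i rnorm (x i)).
  by rewrite ltr_pwDl// sumr_ge0// => i _; exact: rnorm_ge0.
move=> i; rewrite (bigD1 i)//= addrCA lerDl addr_ge0//.
by rewrite sumr_ge0// => j _; exact: rnorm_ge0.
Qed.

Lemma cball_unscale (a : R) x : 0 < a -> cball a x ->
  exists2 z, cball 1 z & x = a%:C *: z.
Proof.
move=> a0 xa; exists (a^-1%:C *: x).
  rewrite -(mulVf (lt0r_neq0 a0)); apply: cballZ => //.
  by rewrite invr_ge0 ltW.
by rewrite scalerA -rmorphM mulfV ?lt0r_neq0// scale1r.
Qed.

Lemma csphereZ (k : R[i]) x : rnorm k = 1 -> csphere x -> csphere (k *: x).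
Proof. by move=> k1 x1 i; rewrite /= rnormZ k1 mul1r. Qed.

Definition coord_set x (j : 'I_m) (v : X) : 'I_m -> X :=
  fun i => if i == j then v else x i.

(* Each coordinate r e, with |e| = 1 and 0 <= r <= 1, is a convex combination *)
(* of e and - e.                                                              *)
Lemma csphere_bound (phi : ('I_m -> X) -> R[i]) (c : R) (e0 : X) :
  rnorm e0 = 1 -> scalar phi -> (forall x, csphere x -> rnorm (phi x) <= c) ->
  forall x, cball 1 x -> rnorm (phi x) <= c.
Proof.
move=> e01 lphi phic.
suff H j : (j <= m)%N -> forall x, cball 1 x ->
    (forall i : 'I_m, (j <= i)%N -> rnorm (x i) = 1) -> rnorm (phi x) <= c.
  by move=> x x1; apply: (H m) => // i; rewrite leqNgt ltn_ord.
elim: j => [_ x _ x1|j IH jm x xb x1]; first by apply: phic => i; exact: x1.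
pose J := Ordinal jm; pose r := rnorm (x J).
have [e e1 xJ] : exists2 e, rnorm e = 1 & x J = r%:C *: e.
  have [x0|x0] := eqVneq (x J) 0.
    by exists e0 => //; rewrite /r x0 rnorm0 scale0r.
  exists (normalize (x J)); first by rewrite rnorm_normalize ?rnorm_gt0.
  by rewrite normalizeE// rnorm_gt0.
have r0 : 0 <= r by exact: rnorm_ge0.
have r1 : r <= 1 by exact: xb.
have bound v : rnorm v = 1 -> rnorm (phi (coord_set x J v)) <= c.
  move=> v1; apply: IH; first exact: ltnW.
    by move=> i; rewrite /coord_set; have [_|_] := eqVneq i J; rewrite ?v1.
  move=> i ji; rewrite /coord_set; have [//|iJ] := eqVneq i J; apply: x1.
  by rewrite ltn_neqAle ji andbT eq_sym.
have -> : x = ((1 + r) / 2)%:C *: coord_set x J e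
            + ((1 - r) / 2)%:C *: coord_set x J (- e).
  apply/funext => i.
  change (x i = ((1 + r) / 2)%:C *: coord_set x J e i
              + ((1 - r) / 2)%:C *: coord_set x J (- e) i).
  rewrite /coord_set; have [->|_] := eqVneq i J.
    rewrite xJ scalerN -scalerBl -rmorphB/=; congr (_%:C *: _); lra.
  rewrite -scalerDl -rmorphD/= -[LHS]scale1r; congr (_ *: _).
  by rewrite -[1]/(1%:C); congr (_%:C); lra.
rewrite (scalarD lphi) !(scalarZ lphi) (le_trans (rnormD _ _))//.
rewrite !rnormM !rnorm_real !ger0_norm; [|lra|lra].
have p1 : 0 <= (1 + r) / 2 by lra.
have p2 : 0 <= (1 - r) / 2 by lra.
have := ler_wpM2l p1 (bound e e1).
have := ler_wpM2l p2 (bound (- e) _); rewrite rnormN => /(_ e1).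
lra.
Qed.

Section mean_functional.
Variable J : X -> X -> R[i].
Hypothesis JP : forall u, rnorm u = 1 ->
  [/\ scalar (J u), forall v, rnorm (J u v) <= rnorm v & J u u = 1].
Hypothesis m0 : (0 < m)%N.

(** The average of norming functionals of the coordinates: it has norm at most 1 for the supremum
    norm and takes the value 1 at [x]. *)
Definition mean_functional (x z : 'I_m -> X) : R[i] :=
  (m%:R^-1)%:C * \sum_i J (x i) (z i).

Let mR : 0 < m%:R :> R. Proof. by rewrite ltr0n. Qed.

Let sum_const (c : R) : \sum_(i < m) c = m%:R * c.
Proof. by rewrite sumr_const card_ord mulr_natl. Qed.

Lemma mean_functional_scalar x : csphere x -> scalar (mean_functional x).
Proof.
move=> x1 a y z; rewrite /mean_functional mulrCA -mulrDr; congr (_ * _).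
rewrite mulr_sumr -big_split/=; apply: eq_bigr => i _.
by have [lJ _ _] := JP (x1 i); exact: lJ.
Qed.

Lemma mean_functional_bound x z a : csphere x -> cball a z ->
  rnorm (mean_functional x z) <= a.
Proof.
move=> x1 za; rewrite /mean_functional rnormM rnorm_real.
rewrite ger0_norm ?invr_ge0 ?ler0n// ler_pdivrMl// -sum_const.
rewrite (le_trans (_ : _ <= \sum_i rnorm (J (x i) (z i))))//.
  elim/big_rec2: _ => [|i b c _ cb]; first by rewrite rnorm0.
  by rewrite (le_trans (rnormD _ _))// lerD2l.
apply: ler_sum => i _; have [_ JN _] := JP (x1 i).
exact: le_trans (JN _) (za i).
Qed.

Lemma mean_functional_id x : csphere x -> mean_functional x x = 1.
Proof.
move=> x1; rewrite /mean_functional (eq_bigr (fun _ => 1)).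
  rewrite sumr_const card_ord -(rmorph_nat (real_complex R) m) -rmorphM/=.
  by rewrite mulVf// lt0r_neq0.
by move=> i _; have [] := JP (x1 i).
Qed.

(** If the mean of [m] numbers with real parts at most 1 exceeds [1 - delta / m], each real part
    exceeds [1 - delta], and exposure in X applies coordinatewise. *)
Lemma mean_functional_exposes : uniformly_exposed X -> forall e : R, 0 < e ->
  exists2 delta : R, 0 < delta & forall x z, csphere x -> csphere z ->
    1 - delta < complex.Re (mean_functional x z) -> cball e (z - x).
Proof.
move=> eX e e0; have [delta d0 dP] := eX _ e0.
exists (delta / m%:R); first by rewrite divr_gt0.
move=> x z x1 z1; rewrite /mean_functional ReZ [_^-1 * _]mulrC ltr_pdivlMr//.
rewrite mulrBl mul1r divfK ?lt0r_neq0// => big i.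
have ReJ j : complex.Re (J (x j) (z j)) <= 1.
  have [_ JN _] := JP (x1 j); rewrite (le_trans (Re_le_rnorm _))//.
  by rewrite (le_trans (JN _))// z1.
have [lJ JN Jx] := JP (x1 i).
have sumRe : complex.Re (\sum_j J (x j) (z j)) =
    \sum_j complex.Re (J (x j) (z j)).
  by apply: (big_morph (@complex.Re R)) => // a b; exact: ReD.
apply: (dP (x i) _ (z i) (x1 i) (ball1_Re lJ JN)); rewrite ?Jx ?z1//.
move: big; rewrite sumRe (bigD1 i)//=.
have : \sum_(j < m | j != i) complex.Re (J (x j) (z j))
    <= \sum_(j < m | j != i) 1 by exact: ler_sum.
rewrite sumr_const cardC1 card_ord -subn1 natrB//; lra.
Qed.

End mean_functional.

End coordinates.

(** * Lindenstrauss' perturbation scheme *)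

Section lindenstrauss.
Context {R : realType} {X : completeNormedModType R[i]} {m k : nat}.
Variable J : X -> X -> R[i].
Hypothesis JP : forall u, rnorm u = 1 ->
  [/\ scalar (J u), forall v, rnorm (J u v) <= rnorm v & J u u = 1].
Hypotheses (m0 : (0 < m)%N) (k0 : (0 < k)%N) (eX : uniformly_exposed X).
Implicit Types (x z : 'I_m -> X) (y w : 'I_k -> X).
Implicit Types T : ('I_m -> X) -> ('I_k -> X) -> R[i].

Local Notation F := (@mean_functional R X m J).
Local Notation G := (@mean_functional R X k J).

Definition bound1 T (C : R) :=
  forall z w, cball 1 z -> cball 1 w -> rnorm (T z w) <= C.

Lemma bound1_scale T (C a b : R) z w : bilinear_form T -> bound1 T C ->
  0 < a -> 0 < b -> cball a z -> cball b w -> rnorm (T z w) <= C * a * b.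
Proof.
move=> bT TC a0 b0 /(cball_unscale a0)[z' z'1 ->] /(cball_unscale b0)[w' w'1 ->].
rewrite (bilinZl bT) (bilinZr bT) !rnormM !rnorm_real !gtr0_norm//.
have ab : 0 <= a * b by rewrite mulr_ge0// ltW.
by have := ler_wpM2l ab (TC _ _ z'1 w'1); lra.
Qed.

Definition perturb (c : R) x y T z w := T z w + c%:C * (F x z * G y w).

Lemma perturb_bilinear c x y T : csphere x -> csphere y -> bilinear_form T ->
  bilinear_form (perturb c x y T).
Proof.
move=> x1 y1 [Tl Tr]; have lF := mean_functional_scalar JP x1.
have lG := mean_functional_scalar JP y1.
by split=> [w|z] a u v; rewrite /perturb ?Tl ?Tr ?lF ?lG; ring.
Qed.

Lemma perturb_dist c x y T a b z w : csphere x -> csphere y -> 0 <= c ->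
  0 <= b -> cball a z -> cball b w ->
  rnorm (perturb c x y T z w - T z w) <= c * a * b.
Proof.
move=> x1 y1 c0 b0 za wb; rewrite /perturb [T z w + _]addrC addrK.
rewrite rnormM [X in _ * X]rnormM rnorm_real ger0_norm// -[leRHS]mulrA.
rewrite ler_wpM2l//.
by rewrite ler_pM ?rnorm_ge0//; exact: mean_functional_bound.
Qed.

(** Only the product of the two functionals is known to be near 1, so each point is located up to a
    phase; since [l * l' = 1], the phases cancel in a bilinear form. *)
Definition exposing (e delta : R) := 0 < delta <= 1 /\
  forall x y z w, csphere x -> csphere y -> csphere z -> csphere w ->
  1 - delta < complex.Re (F x z * G y w) -> exists l l' : R[i],
  [/\ l * l' = 1, rnorm l = 1, rnorm l' = 1, cball e (l *: z - x) &
      cball e (l' *: w - y)].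

Lemma exposing_exists e : 0 < e -> exists delta, exposing e delta.
Proof.
move=> e0; have [d1 d10 d1P] := mean_functional_exposes JP m0 eX e0.
have [d2 d20 d2P] := mean_functional_exposes JP k0 eX e0.
exists (Num.min 1 (Num.min d1 d2)); split.
  by rewrite !lt_min ltr01 d10 d20 ge_min lexx.
set d := Num.min 1 _; have [dle1 [dled1 dled2]] : d <= 1 /\ d <= d1 /\ d <= d2.
  by rewrite /d !ge_min !lexx !orbT.
move=> x y z w x1 y1 z1 w1 big.
have Fz : rnorm (F x z) <= 1.
  exact: (mean_functional_bound JP m0 x1 (csphere_cball z1)).
have Gw : rnorm (G y w) <= 1.
  exact: (mean_functional_bound JP k0 y1 (csphere_cball w1)).
have [l l1 lF] := phase (F x z); have [l' l'1 ll'] := conj_phase l1.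
have lFz : F x (l *: z) = (rnorm (F x z))%:C.
  by rewrite (scalarZ (mean_functional_scalar JP x1)).
have FG : F x z * G y w = (rnorm (F x z))%:C * G y (l' *: w).
  rewrite -lF (scalarZ (mean_functional_scalar JP y1)).
  by rewrite -[LHS]mul1r -ll'; ring.
exists l, l'; split=> //.
  apply: d1P; rewrite ?lFz//=; first exact: csphereZ.
  have := le_trans (Re_le_rnorm _) (_ : rnorm (F x z * G y w) <= rnorm (F x z)).
  rewrite rnormM ler_piMr ?rnorm_ge0// => /(_ isT); lra.
apply: d2P => //; first exact: csphereZ.
move: big; rewrite FG ReZ => big; apply: le_lt_trans (_ : 1 - d < _); first lra.
have [g0|g0] := leP 0 (complex.Re (G y (l' *: w))).
  by rewrite (lt_le_trans big)// ler_piMl.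
by have := mulr_ge0_le0 (rnorm_ge0 (F x z)) (ltW g0); lra.
Qed.

(** At [(x, y)] the perturbation gains its full size [c]. A near-maximizer [(z, w)] of the perturbed
    form gains at most [gamma] from [T], so it must have [Re (F x z * G y w) > 1 - delta] and is
    close to [(x, y)] after rotation. *)
Lemma lindenstrauss_step T x y (C c e delta gamma gamma' : R) :
  bilinear_form T -> bound1 T C -> csphere x -> csphere y ->
  (forall z w, csphere z -> csphere w ->
    complex.Re (T z w) <= complex.Re (T x y) + gamma) ->
  0 < c -> exposing e delta -> gamma < c * delta / 2 -> 0 < gamma' ->
  exists x' y', [/\ csphere x', csphere y', cball e (x' - x), cball e (y' - y) &
    forall z w, csphere z -> csphere w -> complex.Re (perturb c x y T z w)
      <= complex.Re (perturb c x y T x' y') + gamma'].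
Proof.
move=> bT TC x1 y1 Tmax c0 [/andP[d0 d1] dP] gc g'0.
have cd : 0 < c * delta by rewrite mulr_gt0.
pose A := [set r | exists z w, [/\ csphere z, csphere w &
  r = complex.Re (perturb c x y T z w)]].
have supA : has_sup A.
  split; first by exists (complex.Re (perturb c x y T x y)), x, y.
  exists (C + c * 1 * 1) => _ [z [w [z1 w1 ->]]].
  rewrite (le_trans (Re_le_rnorm _))//.
  have z1' := csphere_cball z1; have w1' := csphere_cball w1.
  have := perturb_dist T x1 y1 (ltW c0) ler01 z1' w1'.
  have := TC _ _ z1' w1'.
  by have := rnormB_le (perturb c x y T z w) (T z w); lra.
pose mu := Num.min gamma' (c * delta / 2).
have mu0 : 0 < mu by rewrite lt_min g'0; lra.
have [mu1 mu2] : mu <= gamma' /\ mu <= c * delta / 2.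
  by rewrite /mu !ge_min !lexx orbT.
have [_ [z [w [z1 w1 ->]]] zw] := sup_adherent mu0 supA.
have best u v : csphere u -> csphere v ->
    complex.Re (perturb c x y T u v) <= complex.Re (perturb c x y T z w) + mu.
  move=> u1 v1; have : complex.Re (perturb c x y T u v) <= sup A.
    by apply: ub_le_sup; [exact: supA.2|exists u, v].
  by lra.
have Fx := mean_functional_id JP m0 x1; have Gy := mean_functional_id JP k0 y1.
have big : 1 - delta < complex.Re (F x z * G y w).
  rewrite -(ltr_pM2l c0); have := best _ _ x1 y1; have := Tmax _ _ z1 w1.
  rewrite /perturb !ReD !ReZ [F x x]Fx [G y y]Gy mulr1 /=; lra.
have [l [l' [ll' l1 l'1 zx wy]]] := dP _ _ _ _ x1 y1 z1 w1 big.
exists (l *: z), (l' *: w); split=> //; try exact: csphereZ.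
move=> u v u1 v1.
have bP := perturb_bilinear c x1 y1 bT.
rewrite (bilinZl bP) (bilinZr bP) mulrA ll' mul1r.
by have := best _ _ u1 v1; lra.
Qed.

(** Step [n] perturbs by [c / 2^n] and moves the points by at most [e / 2^n], so forms and points
    converge. The maximality defect tends to 0, hence the limit form attains its maximal real part
    at the limit point. *)
Lemma lindenstrauss (c e : R) : 0 < c -> 0 < e -> exists2 gamma : R, 0 < gamma &
  forall T C x0 y0, bilinear_form T -> bound1 T C -> csphere x0 -> csphere y0 ->
  (forall z w, csphere z -> csphere w ->
    complex.Re (T z w) <= complex.Re (T x0 y0) + gamma) ->
  exists S x y, [/\ bilinear_form S, bound1 (fun z w => T z w - S z w) (2 * c),
    csphere x /\ csphere y, cball (2 * e) (x0 - x) /\ cball (2 * e) (y0 - y) &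
    forall z w, csphere z -> csphere w ->
      complex.Re (S z w) <= complex.Re (S x y)].
Proof.
move=> c0 e0; have en n : 0 < e * half n by rewrite mulr_gt0// half_gt0.
have cn n : 0 < c * half n by rewrite mulr_gt0// half_gt0.
have [delta dP] := choice (fun n => exposing_exists (en n)).
(* Below the bound [c_n * delta_n / 2] required by the step, and at most [c / 2^n], so the defects
   vanish in the limit. *)
pose gam n := c * half n * delta n / 4.
have gam0 n : 0 < gam n.
  by have [/andP[d0 _] _] := dP n; rewrite divr_gt0// mulr_gt0.
exists (gam 0%N) => // T C x0 y0 bT TC x01 y01 Tmax.
pose st := ((('I_m -> X) -> ('I_k -> X) -> R[i]) * (('I_m -> X) * ('I_k -> X)))%type.
pose P n (s : st) := [/\ bilinear_form s.1, exists D, bound1 s.1 D,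
  csphere s.2.1, csphere s.2.2 & forall z w, csphere z -> csphere w ->
    complex.Re (s.1 z w) <= complex.Re (s.1 s.2.1 s.2.2) + gam n].
pose Q n (s s' : st) := [/\ s'.1 = perturb (c * half n) s.2.1 s.2.2 s.1,
  cball (e * half n) (s'.2.1 - s.2.1) & cball (e * half n) (s'.2.2 - s.2.2)].
have [||f [f0 fP]] := @dependent_choice_nat _ P Q (T, (x0, y0)).
- by split=> //; exists C.
- move=> n [U [x y]] [/= bU [D UD] x1 y1 Umax].
  have gd : gam n < c * half n * delta n / 2.
    by have := gam0 n; rewrite /gam; lra.
  have [x' [y' [x'1 y'1 xx yy max']]] :=
    lindenstrauss_step bU UD x1 y1 Umax (cn n) (dP n) gd (gam0 n.+1).
  exists (perturb (c * half n) x y U, (x', y')); split; split=> //=.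
    exact: perturb_bilinear.
  exists (D + c * half n * 1 * 1) => z w z1 w1.
  have := perturb_dist U x1 y1 (ltW (cn n)) ler01 z1 w1; have := UD _ _ z1 w1.
  by have := rnormB_le (perturb (c * half n) x y U z w) (U z w); lra.
pose U n := (f n).1; pose x n := (f n).2.1; pose y n := (f n).2.2.
have bU n : bilinear_form (U n) by have [[]] := fP n.
have x1 n : csphere (x n) by have [[]] := fP n.
have y1 n : csphere (y n) by have [[]] := fP n.
have Umax n z w : csphere z -> csphere w ->
    complex.Re (U n z w) <= complex.Re (U n (x n) (y n)) + gam n.
  by have [[_ _ _ _ +] _] := fP n; apply.
have US n : U n.+1 = perturb (c * half n) (x n) (y n) (U n).
  by have [_ []] := fP n.
have xS n : cball (e * half n) (x n.+1 - x n) by have [_ []] := fP n.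
have yS n : cball (e * half n) (y n.+1 - y n) by have [_ []] := fP n.
have Ustep a b z w : 0 <= b -> cball a z -> cball b w ->
    forall n, rnorm (U n.+1 z w - U n z w) <= c * a * b * half n.
  move=> b0 za wb n; rewrite US.
  apply: (le_trans (perturb_dist _ (x1 n) (y1 n) (ltW (cn n)) b0 za wb)).
  by rewrite le_eqVlt; apply/orP; left; apply/eqP; ring.
have [L LP] := @complex_fast_lim R.
have [M MP] := @banach_fast_lim R X.
pose S z w := L (fun n => U n z w).
have Sclose a b z w n : 0 <= b -> cball a z -> cball b w ->
    rnorm (U n z w - S z w) <= 2 * (c * a * b) * half n.
  by move=> b0 za wb; apply: LP; exact: Ustep.
have S0 a b z w : 0 <= b -> cball a z -> cball b w ->
    rnorm (T z w - S z w) <= 2 * (c * a * b).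
  move=> b0 za wb; have := Sclose _ _ _ _ 0%N b0 za wb.
  by rewrite /U f0 /half mulr1.
have bS : bilinear_form S.
  have lim_lin (p : R[i]) (u v t : nat -> R[i]) (A B D : R) (l1 l2 l3 : R[i]) :
      (forall n, rnorm (u n - l1) <= A * half n) ->
      (forall n, rnorm (v n - l2) <= B * half n) ->
      (forall n, rnorm (t n - l3) <= D * half n) ->
      (forall n, u n = p * v n + t n) -> l1 = p * l2 + l3.
    move=> uA vB tD uvt; apply/eqP; rewrite -subr_eq0; apply/eqP/rnorm_eq0.
    apply/le_anti; rewrite rnorm_ge0 andbT.
    apply: (@le_half _ (A + rnorm p * B + D)) => n; rewrite add0r.
    have -> : l1 - (p * l2 + l3) = - (u n - l1) + (p * (v n - l2) + (t n - l3)).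
      by rewrite uvt; ring.
    have := rnormD (- (u n - l1)) (p * (v n - l2) + (t n - l3)).
    have := rnormD (p * (v n - l2)) (t n - l3); rewrite rnormN rnormM.
    have := uA n; have := tD n; have := ler_wpM2l (rnorm_ge0 p) (vB n); lra.
  split=> [w|z] p u v.
    have [b b0 wb] := cball_ex w; have b0' := ltW b0.
    have [a1 _ ua] := cball_ex (p *: u + v).
    have [a2 _ va] := cball_ex u; have [a3 _ ta] := cball_ex v.
    apply: lim_lin; [exact: (fun n => Sclose _ _ _ _ n b0' ua wb)
      |exact: (fun n => Sclose _ _ _ _ n b0' va wb)
      |exact: (fun n => Sclose _ _ _ _ n b0' ta wb)|].
    by move=> n; exact: (bU n).1.
  have [a _ za] := cball_ex z.
  have [b1 /ltW b10 ub] := cball_ex (p *: u + v).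
  have [b2 /ltW b20 vb] := cball_ex u; have [b3 /ltW b30 tb] := cball_ex v.
  apply: lim_lin; [exact: (fun n => Sclose _ _ _ _ n b10 za ub)
    |exact: (fun n => Sclose _ _ _ _ n b20 za vb)
    |exact: (fun n => Sclose _ _ _ _ n b30 za tb)|].
  by move=> n; exact: (bU n).2.
pose xl i := M (fun n => x n i); pose yl i := M (fun n => y n i).
have xlP n : cball (2 * e * half n) (x n - xl).
  by move=> i; apply: MP => j; exact: xS.
have ylP n : cball (2 * e * half n) (y n - yl).
  by move=> i; apply: MP => j; exact: yS.
have unit_lim (v : nat -> X) l : (forall n, rnorm (v n) = 1) ->
    (forall n, rnorm (v n - l) <= 2 * e * half n) -> rnorm l = 1.
  move=> v1 vl; apply/le_anti/andP; split; apply: (@le_half _ (2 * e)) => n.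
    have := rnormB_le l (v n); rewrite rnormBC v1; have := vl n; lra.
  by have := rnormB_le (v n) l; rewrite v1; have := vl n; lra.
have xl1 : csphere xl.
  move=> i; apply: (unit_lim (fun n => x n i)) => n; first exact: x1.
  exact: (xlP n i).
have yl1 : csphere yl.
  move=> i; apply: (unit_lim (fun n => y n i)) => n; first exact: y1.
  exact: (ylP n i).
have S1 : bound1 S (C + 2 * c).
  move=> z w z1 w1; have := S0 _ _ _ _ ler01 z1 w1; have := TC _ _ z1 w1.
  by have := rnormB_le (S z w) (T z w); rewrite rnormBC; lra.
exists S, xl, yl; split=> //.
- by move=> z w z1 w1; have := S0 _ _ _ _ ler01 z1 w1; rewrite !mulr1.
- have := xlP 0%N; have := ylP 0%N.
  by rewrite /x /y f0 /half mulr1.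
move=> z w z1 w1.
(* [5 c] collects two replacements of [S] by [U n] and the defect [gam n]; the other term is the
   cost of moving both points to their limits. *)
apply: (@le_half _ (5 * c + (C + 2 * c) * (4 * e))) => n.
have z1' := csphere_cball z1; have w1' := csphere_cball w1.
have xn1 := csphere_cball (x1 n); have yn1 := csphere_cball (y1 n).
have := Umax n _ _ z1 w1.
have le1 : complex.Re (S z w) - complex.Re (U n z w) <= 2 * c * half n.
  rewrite -ReB (le_trans (Re_le_rnorm _))// rnormBC.
  by have := Sclose _ _ _ _ n ler01 z1' w1'; rewrite !mulr1.
have le2 : complex.Re (U n (x n) (y n)) - complex.Re (S (x n) (y n)) <= 2 * c * half n.
  rewrite -ReB (le_trans (Re_le_rnorm _))//.
  by have := Sclose _ _ _ _ n ler01 xn1 yn1; rewrite !mulr1.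
have eh : 0 < 2 * e * half n by have := en n; lra.
have le3 : complex.Re (S (x n) (y n)) - complex.Re (S xl yl)
    <= (C + 2 * c) * (4 * e) * half n.
  rewrite -ReB (le_trans (Re_le_rnorm _))//.
  have -> : S (x n) (y n) - S xl yl = S (x n - xl) (y n) + S xl (y n - yl).
    by rewrite (bilinBl bS) (bilinBr bS) addrA subrK.
  have := bound1_scale bS S1 eh ltr01 (xlP n) yn1.
  have := bound1_scale bS S1 ltr01 eh (csphere_cball xl1) (ylP n).
  have := rnormD (S (x n - xl) (y n)) (S xl (y n - yl)); lra.
have le4 : gam n <= c * half n.
  have [/andP[d0 d1] _] := dP n; rewrite /gam.
  by have := ler_wpM2l (ltW (cn n)) d1; have := mulr_gt0 (cn n) d0; lra.
by have := half_gt0 (R := R) n; lra.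
Qed.

End lindenstrauss.

Section finite_sums.
Context {R : realType} {X : completeNormedModType R[i]} {m k : nat}.
Hypotheses (m0 : (0 < m)%N) (k0 : (0 < k)%N).
Implicit Types (x z : 'I_m -> X) (y w : 'I_k -> X).
Implicit Types T : ('I_m -> X) -> ('I_k -> X) -> R[i].

Lemma csphere_bound1 T (C : R) (e0 : X) : rnorm e0 = 1 -> bilinear_form T ->
  (forall z w, csphere z -> csphere w -> rnorm (T z w) <= C) -> bound1 T C.
Proof.
move=> e01 bT TC z w z1 w1.
apply: (csphere_bound e01 (bT.2 z)) w1 => {}w w1.
by apply: (csphere_bound e01 (bT.1 w)) z1 => {}z z1; exact: TC.
Qed.

Lemma bilinear_form_comp T (U : 'I_m -> X -> X) (V : 'I_k -> X -> X) :
  (forall i, isometry (U i)) -> (forall j, isometry (V j)) -> bilinear_form T ->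
  bilinear_form (fun z w => T (fun i => U i (z i)) (fun j => V j (w j))).
Proof.
move=> IU IV bT; split=> [w|z] a u v.
  rewrite -(bT.1 _); congr (T _ _); apply/funext => i.
  exact: (IU i).1.
rewrite -(bT.2 _); congr (T _ _); apply/funext => j.
exact: (IV j).1.
Qed.

(** The limit form of [lindenstrauss] attains its maximum at a point near [(u, v)]; it is divided by
    that maximum and composed with coordinatewise isometries taking [u] and [v] to that point. These
    are near the identity, so the form changes little. *)
Lemma finite_sum_attains : micro_transitive X -> forall eps : R, 0 < eps ->
  exists2 eta : R, 0 < eta & forall u v T, csphere u -> csphere v ->
    bilinear_form T -> bound1 T 1 -> 1 - eta < complex.Re (T u v) ->
    exists S, [/\ bilinear_form S, bound1 S 1, S u v = 1 &
      bound1 (fun z w => S z w - T z w) eps].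
Proof.
move=> mX eps eps0; have eX := micro_transitive_exposed mX.
have [J JP] : exists J : X -> X -> R[i], forall u, rnorm u = 1 ->
    [/\ scalar (J u), forall v, rnorm (J u v) <= rnorm v & J u u = 1].
  suff /choice[J JP] : forall u : X, exists f : X -> R[i], rnorm u = 1 ->
      [/\ scalar f, forall v, rnorm (f v) <= rnorm v & f u = 1] by exists J.
  move=> u; have [/norming[f fP]|un] := pselect (rnorm u = 1); first by exists f.
  by exists (fun _ => 0) => /un.
pose e1 := Num.min eps 1; have e10 : 0 < e1 by rewrite lt_min eps0 ltr01.
have [e1eps e11] : e1 <= eps /\ e1 <= 1 by rewrite /e1 !ge_min !lexx orbT.
have e18 : 0 < e1 / 8 by lra.
have [theta th0 thP] := micro_transitive_isometry mX e18.
have c0 : 0 < e1 / 32 by lra.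
have e0 : 0 < theta / 4 by lra.
have [gamma g0 gP] := @lindenstrauss R X m k J JP m0 k0 eX _ _ c0 e0.
exists (Num.min gamma (e1 / 4)); first by rewrite lt_min g0; lra.
move=> u v T u1 v1 bT T1; set eta := Num.min _ _ => Tuv.
have [etag etae] : eta <= gamma /\ eta <= e1 / 4.
  by rewrite /eta !ge_min !lexx orbT.
have eta0 : 0 < eta by rewrite lt_min g0; lra.
have [|S1 [p [q [bS1 ST [p1 q1] [up vq] S1max]]]] := gP T 1 u v bT T1 u1 v1.
  move=> z w /csphere_cball z1 /csphere_cball w1.
  by have := T1 _ _ z1 w1; have := Re_le_rnorm (T z w); lra.
pose r := complex.Re (S1 p q).
have r_ge : 1 - eta - e1 / 16 < r.
  have := S1max _ _ u1 v1; rewrite -/r.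
  have := ST _ _ (csphere_cball u1) (csphere_cball v1).
  by have := Re_le_rnorm (T u v - S1 u v); rewrite ReB; lra.
have r_le : r <= 1 + e1 / 16.
  have := ST _ _ (csphere_cball p1) (csphere_cball q1).
  have := T1 _ _ (csphere_cball p1) (csphere_cball q1).
  have := rnormB_le (S1 p q) (T p q); rewrite rnormBC.
  by have := Re_le_rnorm (S1 p q); rewrite -/r; lra.
have r0 : 0 < r by lra.
pose S2 z w := (r^-1)%:C * S1 z w.
have rS2 z w : r%:C * S2 z w = S1 z w.
  by rewrite /S2 mulrA -rmorphM/= mulfV ?mul1r// lt0r_neq0.
have bS2 : bilinear_form S2.
  by split=> [w|z] a s t; rewrite /S2 ?bS1.1 ?bS1.2; ring.
have S21 : bound1 S2 1.
  (* A phase moved into the first argument turns moduli into real parts, which [r] bounds on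
     products of spheres. *)
  apply: (csphere_bound1 (u1 (Ordinal m0)) bS2) => z w z1 w1.
  rewrite -(ler_pM2l r0) mulr1 -[X in X * _]gtr0_norm// -rnorm_real -rnormM rS2.
  apply: rnorm_le_Re => l l1; rewrite -(bilinZl bS1).
  by apply: S1max => //; exact: csphereZ.
have S2pq : S2 p q = 1.
  apply: Re_unit; first by apply: S21; exact: csphere_cball.
  by rewrite /S2 ReZ -/r mulVf// lt0r_neq0.
have /choice[U UP] : forall i, exists Ui : X -> X, [/\ isometry Ui,
    Ui (u i) = p i & forall t, rnorm (Ui t - t) <= e1 / 8 * rnorm t].
  by move=> i; apply: thP => //; rewrite (le_lt_trans (up i))//; lra.
have /choice[V VP] : forall j, exists Vj : X -> X, [/\ isometry Vj,
    Vj (v j) = q j & forall t, rnorm (Vj t - t) <= e1 / 8 * rnorm t].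
  by move=> j; apply: thP => //; rewrite (le_lt_trans (vq j))//; lra.
pose Uz z : 'I_m -> X := fun i => U i (z i).
pose Vw w : 'I_k -> X := fun j => V j (w j).
have Uz1 z : cball 1 z -> cball 1 (Uz z).
  by move=> z1 i; have [IU _ _] := UP i; rewrite /Uz IU.2.
have Vw1 w : cball 1 w -> cball 1 (Vw w).
  by move=> w1 j; have [IV _ _] := VP j; rewrite /Vw IV.2.
have Uzz z : cball 1 z -> cball (e1 / 8) (Uz z - z).
  move=> z1 i; have [_ _ Ui] := UP i; apply: (le_trans (Ui (z i))).
  by rewrite ler_piMr// ltW.
have Vww w : cball 1 w -> cball (e1 / 8) (Vw w - w).
  move=> w1 j; have [_ _ Vj] := VP j; apply: (le_trans (Vj (w j))).
  by rewrite ler_piMr// ltW.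
have UzE : Uz u = p by apply/funext => i; have [] := UP i.
have VwE : Vw v = q by apply/funext => j; have [] := VP j.
exists (fun z w => S2 (Uz z) (Vw w)); split.
- by apply: bilinear_form_comp bS2 => i; [have [] := UP i|have [] := VP i].
- by move=> z w z1 w1; apply: S21; [exact: Uz1|exact: Vw1].
- by rewrite UzE VwE.
move=> z w z1 w1.
have -> : S2 (Uz z) (Vw w) - T z w = S2 (Uz z - z) (Vw w) + S2 z (Vw w - w)
    + (S2 z w - S1 z w) - (T z w - S1 z w).
  by rewrite (bilinBl bS2) (bilinBr bS2); ring.
have h1 := bound1_scale bS2 S21 e18 ltr01 (Uzz _ z1) (Vw1 _ w1).
have h2 := bound1_scale bS2 S21 ltr01 e18 z1 (Vww _ w1).
have h3 : rnorm (S2 z w - S1 z w) <= eta + e1 / 16.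
  rewrite -rS2 -{1}[S2 z w]mul1r -mulrBl rnormM -(rmorphB (real_complex R) 1 r).
  rewrite rnorm_real (le_trans (ler_piMr (normr_ge0 _) (S21 _ _ z1 w1)))//.
  by rewrite ler_norml; apply/andP; split; lra.
have h4 := ST _ _ z1 w1.
have := rnormD (S2 (Uz z - z) (Vw w) + S2 z (Vw w - w) + (S2 z w - S1 z w))
  (- (T z w - S1 z w)).
have := rnormD (S2 (Uz z - z) (Vw w) + S2 z (Vw w - w)) (S2 z w - S1 z w).
have := rnormD (S2 (Uz z - z) (Vw w)) (S2 z (Vw w - w)).
rewrite rnormN; lra.
Qed.

End finite_sums.

(** * Forms on c0(X) *)

Section bilinear_terms.
Context {R : realType} {Z W : normedModType R[i]}.

Lemma bilinear_form_of (T : {bilinear Z -> W -> R[i] | *%R & *%R}) :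
  bilinear_form (fun z w => T z w).
Proof.
split=> [w|z] a u v; [exact: linearPl|exact: linearPr].
Qed.

Lemma bilinear_form_pack (S : Z -> W -> R[i]) : bilinear_form S ->
  exists T : {bilinear Z -> W -> R[i] | *%R & *%R}, forall z w, T z w = S z w.
Proof.
move=> bS; have bS' : bilinear_for *%R *%R S by split; [exact: bS.1|exact: bS.2].
pose B := bilinear_isBilinear.Build R[i] Z W R[i] *%R *%R S bS'.
pose T : {bilinear Z -> W -> R[i] | *%R & *%R} := HB.pack S B.
by exists T.
Qed.

Lemma bilform_norm_le (S : Z -> W -> R[i]) (c : R) :
  (forall z w, rnorm z <= 1 -> rnorm w <= 1 -> rnorm (S z w) <= c) ->
  bilform_norm S <= c.
Proof.
move=> Sc; apply: ge_sup.
  by exists (rnorm (S 0 0)), 0, 0; rewrite !rnorm0.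
by move=> _ [z [w [z1 w1 ->]]]; exact: Sc.
Qed.

Lemma bilform_sphere_le (T : {bilinear Z -> W -> R[i] | *%R & *%R}) z w :
  bilform_sphere T -> rnorm z <= 1 -> rnorm w <= 1 -> rnorm (T z w) <= 1.
Proof.
move=> [bT T1] z1 w1; rewrite -[leRHS]T1; apply: ub_le_sup; first exact: bT.
by exists z, w.
Qed.

Lemma bilform_sphereP (T : {bilinear Z -> W -> R[i] | *%R & *%R}) z w :
  (forall z w, rnorm z <= 1 -> rnorm w <= 1 -> rnorm (T z w) <= 1) ->
  rnorm z <= 1 -> rnorm w <= 1 -> rnorm (T z w) = 1 -> bilform_sphere T.
Proof.
move=> T1 z1 w1 Tzw.
have bT : bilform_bounded (fun z w => T z w).
  by exists 1 => _ [z' [w' [z'1 w'1 ->]]]; exact: T1.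
split=> //; apply/le_anti/andP; split; first exact: bilform_norm_le.
by rewrite -Tzw; apply: ub_le_sup => //; exists z, w.
Qed.

End bilinear_terms.

Section functionals.
Context {R : realType} {X : normedModType R[i]}.

(* phi is almost norming at u, so by smoothness it is almost |phi| f, and *)
(* |phi| is almost Re (phi u).                                            *)
Lemma almost_norming (eps tau kappa : R) (u : X) (phi f : X -> R[i]) :
  (forall h (t : R), 0 <= t <= tau -> rnorm h <= 1 ->
    rnorm (u + t%:C *: h) <= 1 + t * complex.Re (f h) + eps * t) ->
  0 < eps -> 0 < tau -> 0 <= kappa <= 1 -> rnorm u = 1 ->
  scalar phi -> scalar f -> (forall h, rnorm (f h) <= rnorm h) -> rnorm (phi u) <= 1 ->
  (forall h, rnorm h <= 1 -> complex.Re (phi h) <= complex.Re (phi u) + kappa) ->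
  forall h, rnorm h <= 1 -> rnorm (phi h - (complex.Re (phi u))%:C * f h) <=
    kappa / tau + 2 * eps + kappa.
Proof.
move=> smooth e0 t0 /andP[k0 k1] u1 lphi lf fN phiu1 phimax.
set r := complex.Re (phi u).
have r1 : r <= 1 by exact: le_trans (Re_le_rnorm _) phiu1.
have rk0 : 0 <= r + kappa.
  have := phimax 0; rewrite (scalar0 lphi) rnorm0 => /(_ ler01); exact.
have homog v : complex.Re (phi v) <= rnorm v * (r + kappa).
  have [->|v0] := eqVneq v 0; first by rewrite (scalar0 lphi) rnorm0 mul0r.
  have nv := rnorm_gt0 v0.
  rewrite -{1}(normalizeE nv) (scalarZ lphi) ReZ ler_pM2l//.
  by apply: phimax; rewrite rnorm_normalize.
have half h : rnorm h <= 1 ->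
    complex.Re (phi h - r%:C * f h) <= kappa / tau + 2 * eps + kappa.
  move=> h1; rewrite ReB ReZ.
  have tt : 0 <= tau <= tau by rewrite lexx ltW.
  have := ler_wpM2r rk0 (smooth h tau tt h1).
  move=> /(le_trans (homog _)); rewrite (scalarD lphi) (scalarZ lphi) ReD ReZ -/r.
  have fh : complex.Re (f h) <= 1.
    by rewrite (le_trans (Re_le_rnorm _))// (le_trans (fN h)).
  have etk : eps * tau * (r + kappa) <= eps * tau * 2.
    by rewrite ler_wpM2l ?mulr_ge0 ?(ltW e0) ?(ltW t0)//; lra.
  have tkf : tau * kappa * complex.Re (f h) <= tau * kappa * 1.
    by rewrite ler_wpM2l// mulr_ge0// ltW.
  move=> le1; rewrite -(ler_pM2l t0).
  have -> : tau * (kappa / tau + 2 * eps + kappa)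
          = kappa + 2 * eps * tau + tau * kappa by field; rewrite lt0r_neq0.
  by lra.
move=> h h1; apply: rnorm_le_Re => l l1.
have -> : l * (phi h - r%:C * f h) = phi (l *: h) - r%:C * f (l *: h).
  by rewrite (scalarZ lphi) (scalarZ lf); ring.
by apply: half; rewrite rnormZ l1 mul1r.
Qed.

Lemma Im_real_dist (z : R[i]) (a d : R) : rnorm (z - a%:C) <= d ->
  `|complex.Im z| <= d /\ `|complex.Re z - a| <= d.
Proof.
case: z => p q h; split.
  have := normRe_le_rnorm (- 'i * ((p +i* q) - a%:C)).
  rewrite rnormM rnormN rnormi mul1r => /le_trans/(_ h).
  by rewrite /real_complex_def; simpc.
have := normRe_le_rnorm ((p +i* q) - a%:C) => /le_trans/(_ h).
by rewrite /real_complex_def; simpc.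
Qed.

(* For each unit l the functional p + l q is almost a real multiple of f;    *)
(* taking l = 1, -1 and l = i, - i makes both q and i q almost real multiples *)
(* of f, hence q is small.                                                    *)
Lemma rotating_multiples (d : R) (u : X) (p q f : X -> R[i]) (r : R[i] -> R) :
  f u = 1 -> rnorm u <= 1 -> (forall h, rnorm (f h) <= rnorm h) ->
  (forall l h, rnorm l = 1 -> rnorm h <= 1 ->
    rnorm (p h + l * q h - (r l)%:C * f h) <= d) ->
  forall h, rnorm h <= 1 -> rnorm (q h) <= 3 * d.
Proof.
move=> fu u1 fN close.
(* Half the difference of the estimates for [l] and [- l] eliminates [p]. *)
have diff l h : rnorm l = 1 -> rnorm h <= 1 ->
    rnorm (l * q h - ((r l - r (- l)) / 2)%:C * f h) <= d.
  move=> l1 h1; have := close l h l1 h1.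
  have := close (- l) h; rewrite rnormN => /(_ l1 h1) c2 c1.
  have -> : l * q h - ((r l - r (- l)) / 2)%:C * f h =
      (2^-1 : R)%:C * ((p h + l * q h - (r l)%:C * f h)
        - (p h + - l * q h - (r (- l))%:C * f h)).
    have h2 : (2^-1 : R)%:C = 2^-1 :> R[i].
      by rewrite (fmorphV (real_complex R)) rmorph_nat.
    by rewrite [X in _ - X * _]rmorphM rmorphB/= h2; field.
  rewrite rnormM rnorm_real ger0_norm ?invr_ge0//.
  have := rnormD (p h + l * q h - (r l)%:C * f h)
    (- (p h + - l * q h - (r (- l))%:C * f h)).
  by rewrite rnormN; lra.
have d1 := diff 1 u (rnorm1) u1; have di := diff 'i u (rnormi) u1.
rewrite fu !mulr1 mul1r in d1; rewrite fu !mulr1 in di.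
have [Im1 Re1] := Im_real_dist d1; have [Imi _] := Im_real_dist di.
rewrite mulrC ImiRe in Imi.
move=> h h1; have := diff 1 h (rnorm1) h1; rewrite mul1r.
set a := (r 1 - r (- 1)) / 2 in d1 Re1 *.
(* At [u], where [f u = 1], the case [l = 'i] bounds [Re (q u)] by [d], and [l = 1] puts it within
   [d] of [a]. *)
have a2 : `|a| <= 2 * d.
  move: Re1 Imi; rewrite !ler_norml => /andP[? ?] /andP[? ?].
  by apply/andP; split; lra.
have := rnormB_le (q h) (a%:C * f h); rewrite rnormM rnorm_real.
have : `|a| * rnorm (f h) <= `|a|.
  by rewrite ler_piMr// (le_trans (fN h)).
by lra.
Qed.

End functionals.

(** * Norm-one coordinates and finite blocks in c0(X) *)

Section c0_coordinates.
Context {R : realType} {X : normedModType R[i]}.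
Implicit Types x y : c0 X.

Lemma rnorm_coord_le x i : rnorm (x i) <= rnorm x.
Proof. exact: c0_norm_ub. Qed.

Lemma rnorm_c0_le x (M : R) : (forall i, rnorm (x i) <= M) -> rnorm x <= M.
Proof. exact: c0_norm_le. Qed.

Lemma c0D x y i : (x + y) i = x i + y i. Proof. by []. Qed.
Lemma c0N x i : (- x) i = - x i. Proof. by []. Qed.
Lemma c0Z a x i : (a *: x) i = a *: x i. Proof. by []. Qed.

Lemma max_lt1 (f : nat -> R) (L : seq nat) : (forall n, n \in L -> f n < 1) ->
  exists2 rho : R, 0 <= rho < 1 & forall n, n \in L -> f n <= rho.
Proof.
elim: L => [|n L IH] fL; first by exists 0; rewrite ?lexx ?ltr01.
have [|rho /andP[r0 r1] rP] := IH; first by move=> j jL; rewrite fL// inE jL orbT.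
exists (Num.max rho (f n)).
  by rewrite le_max r0/= gt_max r1 fL// inE eqxx.
move=> j; rewrite inE le_max => /predU1P[->|/rP ->//].
by rewrite lexx orbT.
Qed.

(** Beyond some [N] the norms are below 1/2, and only finitely many coordinates remain, so the norms
    different from 1 stay below a common [rho < 1]. Some coordinate has norm 1, as otherwise the
    norm of [x] would be at most [rho]. *)
Lemma c0_norming_coords x : rnorm x = 1 -> exists (m : nat) (a : 'I_m -> nat)
  (rho : R), [/\ (0 < m)%N, injective a, forall i, rnorm (x (a i)) = 1,
    0 <= rho < 1 & forall n, (forall i, a i != n) -> rnorm (x n) <= rho].
Proof.
move=> x1; have [N _ Nx] : \forall n \near \oo, rnorm (x n) < 2^-1.
  have /cvgrPdist_lt/(_ 2^-1) := c0P x; rewrite invr_gt0 ltr0n => /(_ isT).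
  apply: filterS => n; rewrite sub0r normrN ger0_norm//.
  exact: rnorm_ge0.
have {}Nx n : (N <= n)%N -> rnorm (x n) < 2^-1 by move=> /Nx.
pose s := [seq n <- iota 0 N | rnorm (x n) == 1].
have [|rho' /andP[r0 r1] rP] :=
    @max_lt1 (fun n => rnorm (x n)) [seq n <- iota 0 N | rnorm (x n) != 1].
  move=> n; rewrite mem_filter => /andP[n1 _].
  by rewrite lt_neqAle n1 -x1 rnorm_coord_le.
pose rho := Num.max rho' 2^-1.
have rho1 : rho < 1 by rewrite gt_max r1 invf_lt1// ltr1n.
have xs n : n \notin s -> rnorm (x n) <= rho.
  rewrite mem_filter mem_iota add0n negb_and le_max.
  have [nN|/Nx/ltW ->] := ltnP n N; last by rewrite orbT.
  rewrite orbF => n1; rewrite rP// mem_filter n1 mem_iota add0n.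
  by rewrite nN.
have us : uniq s by rewrite filter_uniq// iota_uniq.
exists (size s), (fun i => nth 0%N s i), rho; split.
- rewrite lt0n; apply/negP => /eqP/size0nil s0.
  have : rnorm x <= rho by apply: rnorm_c0_le => n; apply: xs; rewrite s0.
  by rewrite x1; lra.
- move=> i j /eqP; rewrite nth_uniq// => /eqP; exact: val_inj.
- move=> i; have := mem_nth 0%N (ltn_ord i).
  by rewrite mem_filter => /andP[/eqP].
- by rewrite rho1 andbT le_max r0.
move=> n an; apply: xs; apply/negP => /(nthP 0%N)[j js jn].
by have := an (Ordinal js); rewrite /= jn eqxx.
Qed.

Section embedding.
Context {m : nat} (a : 'I_m -> nat).

Lemma emb_c0 (z : 'I_m -> X) :
  (fun n => \sum_(i | a i == n) z i) \in @c0_pred R X.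
Proof.
apply/asboolP; apply: cvg_near_cst; exists (\max_i a i).+1 => // n /= an.
rewrite big1 ?rnorm0// => i /eqP ain; move: an.
by rewrite -ain ltnNge leq_bigmax.
Qed.

Definition emb (z : 'I_m -> X) : c0 X := C0 (emb_c0 z).

Definition restr (x : c0 X) : 'I_m -> X := fun i => x (a i).

Definition vanishing (x : c0 X) := forall i, x (a i) = 0.

Lemma embP (c : R[i]) z z' : emb (c *: z + z') = c *: emb z + emb z'.
Proof.
apply/val_inj/funext => n; change (\sum_(i | a i == n) (c *: z i + z' i) =
  c *: \sum_(i | a i == n) z i + \sum_(i | a i == n) z' i).
by rewrite big_split/= scaler_sumr.
Qed.

Hypothesis inja : injective a.

Lemma emb_in z i : emb z (a i) = z i.
Proof.
rewrite /emb/= (big_pred1 i)// => j; apply/eqP/eqP => [|->//]; exact: inja.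
Qed.

Lemma emb_out z n : (forall i, a i != n) -> emb z n = 0.
Proof. by move=> an; rewrite /emb/= big1// => i /eqP ain; have := an i; rewrite ain eqxx. Qed.

Lemma in_or_out n : (exists i, a i = n) \/ (forall i, a i != n).
Proof.
have [[i ain]|nex] := pselect (exists i, a i = n); first by left; exists i.
by right => i; apply/eqP => ain; apply: nex; exists i.
Qed.

Lemma rnorm_emb z (c : R) : 0 <= c -> cball c z -> rnorm (emb z) <= c.
Proof.
move=> c0 zc; apply: rnorm_c0_le => n; have [[i <-]|an] := in_or_out n.
  by rewrite emb_in; exact: zc.
by rewrite emb_out// rnorm0.
Qed.

Lemma vanishing_rest x : vanishing (x - emb (restr x)).
Proof. by move=> i; rewrite c0D c0N emb_in subrr. Qed.

Lemma rnorm_rest x : rnorm (x - emb (restr x)) <= rnorm x.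
Proof.
apply: rnorm_c0_le => n; rewrite c0D c0N; have [[i <-]|an] := in_or_out n.
  by rewrite emb_in subrr rnorm0 rnorm_ge0.
by rewrite emb_out// subr0 rnorm_coord_le.
Qed.

Lemma cball_restr x : rnorm x <= 1 -> cball 1 (restr x).
Proof. by move=> x1 i; exact: le_trans (rnorm_coord_le _ _) x1. Qed.

Lemma emb_sum z : emb z = \sum_i emb (coord_set 0 i (z i)).
Proof.
have emb0 : emb 0 = 0.
  by have := embP 1 0 0; rewrite !scale1r addr0 -{1}(addr0 (emb 0)) => /addrI/esym.
have embD z1 z2 : emb (z1 + z2) = emb z1 + emb z2.
  by have := embP 1 z1 z2; rewrite !scale1r.
rewrite -(big_morph emb embD emb0); congr emb; apply/funext => j.
rewrite fct_sumE (bigD1 j)//= big1 ?addr0 /coord_set ?eqxx// => i ij.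
by rewrite eq_sym (negbTE ij).
Qed.

End embedding.

End c0_coordinates.

(** * Forms that nearly attain their norm are close to a block *)

Section perturbations.
Context {R : realType} {V W : normedModType R[i]} (T : V -> W -> R[i]).
Hypotheses (bT : bilinear_form T)
  (T1 : forall v w, rnorm v <= 1 -> rnorm w <= 1 -> rnorm (T v w) <= 1).
Context (v0 : V) (w0 : W) (eta : R).
Hypotheses (v01 : rnorm v0 <= 1) (w01 : rnorm w0 <= 1)
  (Tvw : 1 - eta < complex.Re (T v0 w0)).

Definition admissible (U : normedModType R[i]) (u0 u : U) :=
  forall l : R[i], rnorm l = 1 -> rnorm (u0 + l *: u) <= 1.

Lemma perturbr_small w : admissible w0 w -> rnorm (T v0 w) <= eta.
Proof.
move=> ww; apply: rnorm_le_Re => l l1; rewrite -(bilinZr bT).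
have := le_trans (Re_le_rnorm _) (T1 v01 (ww l l1)).
by rewrite (bilinDr bT) ReD; move: Tvw; lra.
Qed.

(** Adding the values at [(v0 + l v, w0 + w)] and [(v0 - l v, w0 - w)] cancels the mixed terms and
    leaves twice [T v0 w0 + l * T v w], of real part at most 2. *)
Lemma perturb_small v w : admissible v0 v -> admissible w0 w ->
  rnorm (T v w) <= eta.
Proof.
move=> vv ww; apply: rnorm_le_Re => l l1.
have lN : rnorm (- l) = 1 by rewrite rnormN.
have N1 : rnorm (- 1 : R[i]) = 1 by rewrite rnormN rnorm1.
have := le_trans (Re_le_rnorm _) (T1 (vv l l1) (ww 1 rnorm1)).
have := le_trans (Re_le_rnorm _) (T1 (vv _ lN) (ww _ N1)).
have e : T (v0 + l *: v) (w0 + 1 *: w) + T (v0 + - l *: v) (w0 + - 1 *: w)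
    = (T v0 w0 + l * T v w) + (T v0 w0 + l * T v w).
  by rewrite !(bilinDl bT) !(bilinDr bT) !(bilinZl bT) !(bilinZr bT); ring.
by have := congr1 (@complex.Re R) e; rewrite !ReD; move: Tvw; lra.
Qed.

End perturbations.

Section cross_terms.
Context {R : realType} {X : normedModType R[i]}.
Hypothesis sX : uniformly_smooth X.
Context {m : nat} (a : 'I_m -> nat) (x0 : c0 X).
Hypotheses (inja : injective a) (m0 : (0 < m)%N) (x01 : rnorm x0 <= 1)
  (ax0 : forall i, rnorm (x0 (a i)) = 1).

(** Replacing one norm-one coordinate of [x0] by any [h] in the ball keeps the norm at most 1, while
    [T x0 (y0 + l *: y)] has real part above [1 - 2 eta]. So on that coordinate
    [T (-) (y0 + l *: y)] nearly attains its norm at the coordinate of [x0], for every unimodular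
    [l]; [almost_norming] and [rotating_multiples] then make [T (-) y] small. *)
Lemma cross_small (zeta : R) : 0 < zeta -> exists2 eta : R, 0 < eta &
  forall (W : normedModType R[i]) (T : c0 X -> W -> R[i]) (y0 y : W),
  bilinear_form T ->
  (forall v w, rnorm v <= 1 -> rnorm w <= 1 -> rnorm (T v w) <= 1) ->
  rnorm y0 <= 1 -> 1 - eta < complex.Re (T x0 y0) -> admissible y0 y ->
  forall z, cball 1 z -> rnorm (T (emb a z) y) <= zeta.
Proof.
move=> z0; have mR : 0 < m%:R :> R by rewrite ltr0n.
have m12 : 0 < zeta / (12 * m%:R) by rewrite divr_gt0// mulr_gt0.
have [tau t0 tauP] := sX m12.
have it : 0 < tau^-1 by rewrite invr_gt0.
(* The bound 1/2 keeps the defect [2 * eta] at most 1; the other makes [3 * d <= zeta / m], to be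
   summed over [m] coordinates. *)
pose eta := Num.min 2^-1 (zeta / (12 * m%:R) / (tau^-1 + 1)).
have eta0 : 0 < eta.
  by rewrite lt_min invr_gt0 ltr0n/= divr_gt0// addr_gt0.
have [eta2 etam] : eta <= 2^-1 /\ eta * (tau^-1 + 1) <= zeta / (12 * m%:R).
  rewrite -ler_pdivlMr ?addr_gt0//.
  by rewrite /eta !ge_min !lexx orbT.
exists eta => // W T y0 y bT T1 y01 Txy yy z z1.
pose e (i : 'I_m) (h : X) : c0 X := emb a (coord_set 0 i h).
have eL i c h h' : e i (c *: h + h') = c *: e i h + e i h'.
  rewrite /e -embP; congr emb; apply/funext => j.
  change (coord_set 0 i (c *: h + h') j
    = c *: coord_set 0 i h j + coord_set 0 i h' j).
  by rewrite /coord_set; have [//|_] := eqVneq j i; rewrite scaler0 addr0.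
have eB i h h' : e i (h - h') = e i h - e i h'.
  by rewrite addrC -scaleN1r eL scaleN1r addrC.
have ein i h : e i h (a i) = h by rewrite /e emb_in// /coord_set eqxx.
have eout i h n : a i != n -> e i h n = 0.
  move=> ain; have [[j jn]|an] := in_or_out a n; last by rewrite /e emb_out.
  rewrite -jn /e emb_in// /coord_set; have [ji|//] := eqVneq j i.
  by rewrite -jn ji eqxx in ain.
have e1 i h : rnorm h <= 1 -> rnorm (e i h) <= 1.
  move=> h1; apply: rnorm_emb => // j; rewrite /coord_set.
  by have [//|_] := eqVneq j i; rewrite rnorm0.
have xe1 i h : rnorm h <= 1 -> rnorm (x0 + e i (h - x0 (a i))) <= 1.
  move=> h1; apply: rnorm_c0_le => n; rewrite c0D.
  have [<-|ain] := eqVneq (a i) n; first by rewrite ein addrC subrK.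
  by rewrite eout// addr0 (le_trans (rnorm_coord_le _ _)).
pose d := 2 * eta / tau + 2 * (zeta / (12 * m%:R)) + 2 * eta.
have dm : 3 * d <= zeta / m%:R.
  have -> : zeta / m%:R = 12 * (zeta / (12 * m%:R)).
    by field; rewrite lt0r_neq0.
  by rewrite /d; move: etam; rewrite mulrDr mulr1; lra.
have coord i h : rnorm h <= 1 -> rnorm (T (e i h) y) <= 3 * d.
  pose u := x0 (a i); have u1 : rnorm u = 1 by exact: ax0.
  have [f [lf fN fu]] := norming u1.
  have smooth h' (t : R) : 0 <= t <= tau -> rnorm h' <= 1 -> rnorm (u + t%:C *: h')
      <= 1 + t * complex.Re (f h') + zeta / (12 * m%:R) * t.
    move=> tt h'1; apply: (tauP u (fun x => complex.Re (f x))) => //.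
      exact: ball1_Re.
    by rewrite fu.
  pose phi l h' := T (e i h') (y0 + l *: y).
  apply: (@rotating_multiples _ _ d u (fun h' => T (e i h') y0)
    (fun h' => T (e i h') y) f (fun l => complex.Re (phi l u))) => //.
    by rewrite u1.
  move=> l h' l1 h'1.
  have -> : T (e i h') y0 + l * T (e i h') y = phi l h'.
    by rewrite /phi (bilinDr bT) (bilinZr bT).
  have lphi : scalar (phi l).
    by move=> c p q; rewrite /phi eL; exact: (bT.1 _).
  apply: (almost_norming smooth m12 t0 _ u1 lphi lf fN) => //.
  - by apply/andP; split; lra.
  - by apply: T1; [apply: e1; rewrite u1|exact: yy].
  move=> h2 h21; have := le_trans (Re_le_rnorm _) (T1 _ _ (xe1 i h2 h21) (yy l l1)).
  rewrite (bilinDl bT) eB (bilinBl bT) ReD ReB -/(phi l h2) -/u -/(phi l u).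
  have := perturbr_small bT T1 x01 Txy yy.
  have : - rnorm (T x0 y) <= complex.Re (l * T x0 y).
    have := normRe_le_rnorm (l * T x0 y); rewrite rnormM l1 mul1r ler_norml.
    by move=> /andP[].
  rewrite (bilinDr bT) (bilinZr bT) ReD; lra.
rewrite emb_sum (scalar_sum (bT.1 y)).
apply: (@le_trans _ _ (\sum_(i < m) 3 * d)); last first.
  by rewrite sumr_const card_ord -[leLHS]mulr_natr -ler_pdivlMr.
elim/big_rec2: _ => [|i b c _ cb]; first by rewrite rnorm0.
by rewrite (le_trans (rnormD _ _))// lerD// coord.
Qed.

End cross_terms.

(** The factor [1 - rho] fits the perturbation into the room left outside the norm-one
    coordinates. *)
Lemma vanishing_admissible (R : realType) (X : normedModType R[i]) (m : nat)
    (a : 'I_m -> nat) (rho : R) (x0 x : c0 X) : 0 <= rho < 1 ->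
  (forall i, rnorm (x0 (a i)) = 1) ->
  (forall n, (forall i, a i != n) -> rnorm (x0 n) <= rho) ->
  vanishing a x -> rnorm x <= 1 -> admissible x0 ((1 - rho)%:C *: x).
Proof.
move=> /andP[r0 r1] ax0 out van x1 l l1; apply: rnorm_c0_le => n.
rewrite c0D !c0Z; have [[i <-]|an] := in_or_out a n.
  by rewrite van !scaler0 addr0 ax0.
rewrite (le_trans (rnormD _ _))// rnormZ l1 mul1r rnormZr ger0_norm; last lra.
have r' : 0 <= 1 - rho by lra.
have := ler_wpM2l r' (le_trans (rnorm_coord_le x n) x1).
by have := out n an; lra.
Qed.

(** The difference splits into a part off both blocks, bounded by [perturb_small], and two mixed
    parts, bounded by [cross_small] for [T] and for [T] with its arguments exchanged. The factors
    [s] and [t] undo the scaling that makes the rests admissible. *)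
Lemma block_close (R : realType) (X : normedModType R[i]) (m k : nat)
    (a : 'I_m -> nat) (b : 'I_k -> nat) (x0 y0 : c0 X) (rho sigma : R) :
  uniformly_smooth X -> (0 < m)%N -> (0 < k)%N -> injective a -> injective b ->
  rnorm x0 <= 1 -> rnorm y0 <= 1 -> 0 <= rho < 1 -> 0 <= sigma < 1 ->
  (forall i, rnorm (x0 (a i)) = 1) -> (forall j, rnorm (y0 (b j)) = 1) ->
  (forall n, (forall i, a i != n) -> rnorm (x0 n) <= rho) ->
  (forall n, (forall j, b j != n) -> rnorm (y0 n) <= sigma) ->
  forall Z : R, 0 < Z -> exists2 eta : R, 0 < eta &
    forall T : c0 X -> c0 X -> R[i], bilinear_form T ->
    (forall x y, rnorm x <= 1 -> rnorm y <= 1 -> rnorm (T x y) <= 1) ->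
    1 - eta < complex.Re (T x0 y0) -> forall x y, rnorm x <= 1 -> rnorm y <= 1 ->
    rnorm (T x y - T (emb a (restr a x)) (emb b (restr b y))) <= Z.
Proof.
move=> sX m0 k0 inja injb x01 y01 rho01 sigma01 ax0 by0 aout bout Z Z0.
pose s := 1 - rho; pose t := 1 - sigma.
have s0 : 0 < s by rewrite subr_gt0; case/andP: rho01.
have t0 : 0 < t by rewrite subr_gt0; case/andP: sigma01.
have zt0 : 0 < Z / 3 * t by rewrite mulr_gt0// divr_gt0.
have zs0 : 0 < Z / 3 * s by rewrite mulr_gt0// divr_gt0.
have st0 : 0 < s * t by rewrite mulr_gt0.
have [etax etax0 crossx] := cross_small sX inja m0 x01 ax0 zt0.
have [etay etay0 crossy] := cross_small sX injb k0 y01 by0 zs0.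
pose eta := Num.min (Num.min etax etay) (Z / 3 * (s * t)).
have eta0 : 0 < eta by rewrite !lt_min etax0 etay0 mulr_gt0// divr_gt0.
have [eta_x eta_y eta_st] :
    [/\ eta <= etax, eta <= etay & eta <= Z / 3 * (s * t)].
  by rewrite /eta !ge_min !lexx !orbT.
exists eta => // T bT T1 Tbig x y x1 y1.
have bTt : bilinear_form (fun y x => T x y) by split; [exact: bT.2|exact: bT.1].
set u := emb a _; set v := emb b _.
have x'1 : rnorm (x - u) <= 1 by exact: le_trans (rnorm_rest inja x) x1.
have y'1 : rnorm (y - v) <= 1 by exact: le_trans (rnorm_rest injb y) y1.
have ax' : admissible x0 (s%:C *: (x - u)).
  by apply: vanishing_admissible => //; exact: vanishing_rest.
have ay' : admissible y0 (t%:C *: (y - v)).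
  by apply: vanishing_admissible => //; exact: vanishing_rest.
have h1 : rnorm (T (x - u) (y - v)) <= Z / 3.
  have := perturb_small bT T1 Tbig ax' ay'.
  rewrite (bilinZl bT) (bilinZr bT) mulrA -rmorphM rnormM rnorm_real gtr0_norm//.
  by move=> /le_trans/(_ eta_st); rewrite mulrC ler_pM2r.
have bigger e : eta <= e -> 1 - e < complex.Re (T x0 y0).
  by move=> etae; rewrite (le_lt_trans _ Tbig)// lerB.
have h2 : rnorm (T u (y - v)) <= Z / 3.
  have := crossx _ T y0 _ bT T1 y01 (bigger _ eta_x) ay' _ (cball_restr a x1).
  by rewrite (bilinZr bT) rnormM rnorm_real gtr0_norm// mulrC ler_pM2r.
have h3 : rnorm (T (x - u) v) <= Z / 3.
  have := crossy _ (fun y x => T x y) x0 _ bTt (fun y x y1 x1 => T1 x y x1 y1)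
    x01 (bigger _ eta_y) ax' _ (cball_restr b y1).
  by rewrite (bilinZl bT) rnormM rnorm_real gtr0_norm// mulrC ler_pM2r.
have -> : T x y - T u v = T (x - u) (y - v) + T u (y - v) + T (x - u) v.
  by rewrite !(bilinBl bT) !(bilinBr bT); ring.
have -> : Z = Z / 3 + Z / 3 + Z / 3 by field.
by rewrite (le_trans (rnormD _ _))// lerD// (le_trans (rnormD _ _))// lerD.
Qed.

Theorem theorem3p3 (R : realType) (X : completeNormedModType R[i])
    (hX : micro_transitive X) :
  property_Lpp (c0 X) (c0 X).
Proof.
move=> eps x0 y0 eps0 x01 y01; have sX := micro_transitive_smooth hX.
have [m [a [rho [m0 inja ax0 rho01 aout]]]] := c0_norming_coords x01.
have [k [b [sigma [k0 injb by0 sigma01 bout]]]] := c0_norming_coords y01.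
have eps4 : 0 < eps / 4 by rewrite divr_gt0.
have [eta1 eta10 finP] := finite_sum_attains m0 k0 hX eps4.
have x0le : rnorm x0 <= 1 by rewrite x01.
have y0le : rnorm y0 <= 1 by rewrite y01.
(* [eta1 / 2] keeps the block value above [1 - eta1]; [eps / 4] is the block's share of the final
   error. *)
pose Z := Num.min (eps / 4) (eta1 / 2).
have Z0 : 0 < Z by rewrite lt_min eps4 divr_gt0.
have [Z1 Z2] : Z <= eps / 4 /\ Z <= eta1 / 2 by rewrite /Z !ge_min !lexx orbT.
have [eta2 eta20 closeP] := block_close sX m0 k0 inja injb x0le y0le rho01
  sigma01 ax0 by0 aout bout Z0.
pose eta := Num.min eta2 (eta1 / 2).
have [eta_1 eta_2] : eta <= eta1 / 2 /\ eta <= eta2.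
  by rewrite /eta !ge_min !lexx orbT.
exists eta; split=> [|T0 T0s T0big]; first by rewrite lt_min eta20 divr_gt0.
(* A phase makes the value at [(x0, y0)] real and nonnegative; its inverse [l'] is restored in
   [S]. *)
have [l l1 lT0] := phase (T0 x0 y0); have [l' l'1 ll'] := conj_phase l1.
have [T TE] : exists T : c0 X -> c0 X -> R[i], forall x y, T x y = l * T0 x y.
  by exists (fun x y => l * T0 x y).
have bT0 := bilinear_form_of T0.
have bT : bilinear_form T.
  by split=> [y|x] c u v; rewrite !TE ?(bT0.1 y) ?(bT0.2 x); ring.
have T1 x y : rnorm x <= 1 -> rnorm y <= 1 -> rnorm (T x y) <= 1.
  by move=> x1 y1; rewrite TE rnormM l1 mul1r bilform_sphere_le.
have Tbig : 1 - eta < complex.Re (T x0 y0) by rewrite TE lT0.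
pose Tf (z : 'I_m -> X) (w : 'I_k -> X) := T (emb a z) (emb b w).
have close x y : rnorm x <= 1 -> rnorm y <= 1 ->
    rnorm (T x y - Tf (restr a x) (restr b y)) <= Z.
  by apply: closeP => //; rewrite (le_lt_trans _ Tbig)// lerB.
have bTf : bilinear_form Tf.
  by split=> [w|z] c u v; rewrite /Tf embP; [exact: (bT.1 _)|exact: (bT.2 _)].
have Tf1 : bound1 Tf 1.
  by move=> z w z1 w1; apply: T1; exact: rnorm_emb.
have Tfbig : 1 - eta1 < complex.Re (Tf (restr a x0) (restr b y0)).
  have := le_trans (Re_le_rnorm _) (close _ _ x0le y0le).
  by rewrite ReB; move: Tbig Z2 eta_1; clear; lra.
have [Sf [bSf Sf1 Sfxy SfT]] := finP _ _ Tf ax0 by0 bTf Tf1 Tfbig.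
pose S (x y : c0 X) := l' * Sf (restr a x) (restr b y).
have bS : bilinear_form S.
  split=> [y|x] c u v; rewrite /S.
    have -> : restr a (c *: u + v) = c *: restr a u + restr a v by [].
    by rewrite (bSf.1 _); ring.
  have -> : restr b (c *: u + v) = c *: restr b u + restr b v by [].
  by rewrite (bSf.2 _); ring.
have [S' S'E] := bilinear_form_pack bS.
have S'xy : rnorm (S' x0 y0) = 1 by rewrite S'E /S Sfxy mulr1.
exists S'; split=> //.
  apply: bilform_sphereP S'xy => // x y x1 y1.
  by rewrite S'E /S rnormM l'1 mul1r; apply: Sf1; exact: cball_restr.
have : eps / 4 + Z < eps by move: Z1 eps0; clear; lra.
apply: le_lt_trans; apply: bilform_norm_le => x y x1 y1; rewrite S'E /S.
have -> : l' * Sf (restr a x) (restr b y) - T0 x y =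
    l' * (Sf (restr a x) (restr b y) - T x y).
  by rewrite mulrBr TE mulrA [l' * l]mulrC ll' mul1r.
rewrite rnormM l'1 mul1r.
rewrite (le_trans (rnorm_triangle _ (Tf (restr a x) (restr b y)) _))// lerD//.
  exact: SfT (cball_restr a x1) (cball_restr b y1).
by rewrite rnormBC; exact: close.
Qed.
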